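(* Let $(F_4)^\sigma=\{\alpha\in F_4\mid\sigma\alpha=\alpha\sigma\}$ and $(F_4)_{E_1}=\{\alpha\in F_4\mid\alpha E_1=E_1\}$. Then $$(F_4)^\sigma=(F_4)_{E_1}\cong Spin(9).$$
   Context: $\mathbb H$ is the field of quaternions with basis $1,e_1,e_2,e_3$; the Cayley algebra is $\mathfrak C=\mathbb H\oplus\mathbb He_4$ with $(m+ae_4)(n+be_4)=(mn-\overline b a)+(a\overline n+bm)e_4$ and $\overline{m+ae_4}=\overline m-ae_4$. $\mathfrak J=\{X\in M(3,\mathfrak C)\mid X^*=X\}$ with $X\circ Y=\frac12(XY+YX)$; its elements are $X=\begin{pmatrix}\xi_1&x_3&\overline x_2\\ \overline x_3&\xi_2&x_1\\ x_2&\overline x_1&\xi_3\end{pmatrix}$, $\xi_i\in\mathbb R$, $x_i\in\mathfrak C$. $F_4$ is the group of $\mathbb R$-linear isomorphisms $\alpha$ of $\mathfrak J$ with $\alpha(X\circ Y)=\alpha X\circ\alpha Y$. $E_1=\mathrm{diag}(1,0,0)\in\mathfrak J$. The involution $\sigma\in F_4$ is $\sigma\begin{pmatrix}\xi_1&x_3&\overline x_2\\ \overline x_3&\xi_2&x_1\\ x_2&\overline x_1&\xi_3\end{pmatrix}=\begin{pmatrix}\xi_1&-x_3&-\overline x_2\\ -\overline x_3&\xi_2&x_1\\ -x_2&\overline x_1&\xi_3\end{pmatrix}$. $Spin(9)$ is the universal (double) covering group of $SO(9)$; $\cong$ is isomorphism of groups (the paper identifies $(F_4)_{E_1}$ with $Spin(9)$).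 *)

(* Defs.v *)
From HB Require Import structures.
From mathcomp Require Import all_boot all_order all_algebra.
From mathcomp Require Import all_classical all_reals all_analysis.
From mathcomp Require Import ring lra.
Set Implicit Arguments.
Unset Strict Implicit.
Unset Printing Implicit Defensive.
Import Order.TTheory GRing.Theory Num.Theory.
Import numFieldNormedType.Exports.
Local Open Scope classical_set_scope.
Local Open Scope ring_scope.

(* [(a0, a1, a2, a3)] stands for [a0 + a1 e_1 + a2 e_2 + a3 e_3], with
   [e_1 e_2 = e_3], [e_2 e_3 = e_1], [e_3 e_1 = e_2] and [e_i^2 = -1]. The
   componentwise ring product that MathComp puts on a product type is never
   used: multiplication is [qmul]. *)
Definition quat (R : realType) : Type := (R^o * R^o * R^o * R^o)%type.
HB.instance Definition _ (R : realType) := GRing.Lmodule.on (quat R).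

(* [(m, a)] stands for [m + a e_4]. *)
Definition cayley (R : realType) : Type := (quat R * quat R)%type.
HB.instance Definition _ (R : realType) := GRing.Lmodule.on (cayley R).

Section CayleyAlgebra.
Variable R : realType.

Definition qconj (x : quat R) : quat R :=
  let: (a0, a1, a2, a3) := x in (a0, - a1, - a2, - a3).

Definition qmul (x y : quat R) : quat R :=
  let: (a0, a1, a2, a3) := x in
  let: (b0, b1, b2, b3) := y in
  (a0 * b0 - a1 * b1 - a2 * b2 - a3 * b3,
   a0 * b1 + a1 * b0 + a2 * b3 - a3 * b2,
   a0 * b2 - a1 * b3 + a2 * b0 + a3 * b1,
   a0 * b3 + a1 * b2 - a2 * b1 + a3 * b0).

Definition cconj (x : cayley R) : cayley R := (qconj x.1, - x.2).

Definition cmul (x y : cayley R) : cayley R :=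
  let: (m, a) := x in
  let: (n, b) := y in
  (qmul m n - qmul (qconj b) a, qmul a (qconj n) + qmul b m).

Definition creal (t : R) : cayley R := ((t, 0, 0, 0), 0).
Definition cre (x : cayley R) : R := x.1.1.1.1.

Lemma cconjK : involutive cconj.
Proof. by case=> -[[[a b] c] d] y; rewrite /cconj /= !opprK. Qed.

Lemma cconjD : {morph cconj : x y / x + y}.
Proof.
case=> [[[[a b] c] d] y] [[[[a' b'] c'] d'] y'].
by congr (_, _) => /=; rewrite ?opprD //; congr (_, _, _, _); rewrite opprD.
Qed.

Lemma cconj0 : cconj 0 = 0.
Proof. by rewrite /cconj /qconj /= !oppr0. Qed.

Lemma cconjZ (t : R) x : cconj (t *: x) = t *: cconj x.
Proof.
case: x => [[[[a b] c] d] y].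
by congr (_, _) => /=; rewrite ?scalerN //; congr (_, _, _, _); rewrite scalerN.
Qed.

Lemma cconj_creal t : cconj (creal t) = creal t.
Proof. by rewrite /cconj /creal /= !oppr0. Qed.

Lemma cconjM x y : cconj (cmul x y) = cmul (cconj y) (cconj x).
Proof.
case: x => [[[[a0 a1] a2] a3] [[[a4 a5] a6] a7]].
case: y => [[[[b0 b1] b2] b3] [[[b4 b5] b6] b7]].
by congr (_, _); congr (_, _, _, _) => /=; cbn; ring.
Qed.

Lemma cconj_id x : cconj x = x -> x = creal (cre x).
Proof.
have N0 (t : R) : - t = t -> t = 0 by lra.
case: x => [[[[a0 a1] a2] a3] [[[a4 a5] a6] a7]] [].
by do 7![move/N0->].
Qed.

End CayleyAlgebra.

(* [cayley R] carries no ring structure, so the library provides neither a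
   scaling by [R] nor a product on these matrices. *)
Definition cmatrix (R : realType) : Type := 'M[cayley R]_3.
HB.instance Definition _ (R : realType) := GRing.Zmodule.on (cmatrix R).

Section CayleyMatrix.
Variable R : realType.

Definition cscalemx (t : R) (X : cmatrix R) : cmatrix R :=
  \matrix_(i, j) (t *: X i j).

Fact cscalemxA a b X : cscalemx a (cscalemx b X) = cscalemx (a * b) X.
Proof. by apply/matrixP => i j; rewrite !mxE scalerA. Qed.
Fact cscale1mx : left_id 1 cscalemx.
Proof. by move=> X; apply/matrixP => i j; rewrite !mxE scale1r. Qed.
Fact cscalemxDr : right_distributive cscalemx +%R.
Proof. by move=> a X Y; apply/matrixP => i j; rewrite !mxE scalerDr. Qed.
Fact cscalemxDl X : {morph cscalemx^~ X : a b / a + b}.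
Proof. by move=> a b; apply/matrixP => i j; rewrite !mxE scalerDl. Qed.

HB.instance Definition _ := GRing.Zmodule_isLmodule.Build R (cmatrix R)
  cscalemxA cscale1mx cscalemxDr cscalemxDl.

Definition cmulmx (X Y : cmatrix R) : cmatrix R :=
  \matrix_(i, j) \sum_k cmul (X i k) (Y k j).

Definition cadj (X : cmatrix R) : cmatrix R := \matrix_(i, j) cconj (X j i).

Definition herm_pred : {pred cmatrix R} := [pred X | cadj X == X].

Lemma cadjD : {morph cadj : X Y / X + Y}.
Proof. by move=> X Y; apply/matrixP => i j; rewrite !mxE cconjD. Qed.

Lemma cadjZ t X : cadj (t *: X) = t *: cadj X.
Proof. by apply/matrixP => i j; rewrite !mxE cconjZ. Qed.

Lemma cadjM X Y : cadj (cmulmx X Y) = cmulmx (cadj Y) (cadj X).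
Proof.
apply/matrixP => i j; rewrite !mxE (big_morph _ (@cconjD R) (cconj0 R)).
by apply: eq_bigr => k _; rewrite !mxE cconjM.
Qed.

Fact herm_submod_closed : submod_closed herm_pred.
Proof.
split=> [|t X Y /eqP hX /eqP hY]; rewrite inE.
  by apply/eqP/matrixP => i j; rewrite !mxE cconj0.
by apply/eqP; rewrite cadjD cadjZ hX hY.
Qed.

HB.instance Definition _ :=
  GRing.isSubmodClosed.Build R (cmatrix R) herm_pred herm_submod_closed.

End CayleyMatrix.

Arguments herm_pred R _ : clear implicits.

Record jordan (R : realType) := Jordan {
  jmx :> cmatrix R;
  _ : jmx \in herm_pred R
}.

HB.instance Definition _ (R : realType) := [isSub for @jmx R].
HB.instance Definition _ (R : realType) := [Choice of jordan R by <:].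
HB.instance Definition _ (R : realType) :=
  [SubChoice_isSubLmodule of jordan R by <:].

Section JordanAlgebra.
Variable R : realType.
Local Notation J := (jordan R).

Fact jmul_subproof (X Y : J) :
  2^-1 *: (cmulmx X Y + cmulmx Y X) \in herm_pred R.
Proof.
case: X Y => [X /eqP hX] [Y /eqP hY] /=.
by rewrite inE cadjZ cadjD !cadjM hX hY addrC.
Qed.
Definition jmul (X Y : J) : J := Jordan (jmul_subproof X Y).

Definition jelt_mx (xi1 xi2 xi3 : R) (x1 x2 x3 : cayley R) : cmatrix R :=
  \matrix_(i, j) nth 0 (nth [::]
    [:: [:: creal xi1; x3;        cconj x2 ];
        [:: cconj x3;  creal xi2; x1       ];
        [:: x2;        cconj x1;  creal xi3]] i) j.

Fact jelt_subproof xi1 xi2 xi3 x1 x2 x3 :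
  jelt_mx xi1 xi2 xi3 x1 x2 x3 \in herm_pred R.
Proof.
apply/eqP/matrixP => i j; rewrite !mxE.
by case: i j => [[|[|[|//]]] ?] [[|[|[|//]]] ?] /=; rewrite ?cconjK ?cconj_creal.
Qed.
Definition jelt xi1 xi2 xi3 x1 x2 x3 : J :=
  Jordan (jelt_subproof xi1 xi2 xi3 x1 x2 x3).

Definition jxi (i : 'I_3) (X : J) : R := cre (jmx X i i).
Definition jx1 (X : J) : cayley R := jmx X 1 2.
Definition jx2 (X : J) : cayley R := jmx X 2 0.
Definition jx3 (X : J) : cayley R := jmx X 0 1.

Lemma jelt_coord X :
  X = jelt (jxi 0 X) (jxi 1 X) (jxi 2 X) (jx1 X) (jx2 X) (jx3 X).
Proof.
apply/val_inj/matrixP => i j; case: X => X /= hX; rewrite mxE.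
have h k l : X k l = cconj (X l k) by rewrite -{1}(eqP hX) mxE.
have d k : X k k = creal (cre (X k k)) by apply: cconj_id; rewrite -h.
case: i j => [[|[|[|//]]] hi] [[|[|[|//]]] hj] /=;
  rewrite /jxi /jx1 /jx2 /jx3 /= -?d -?h; congr (X _ _); exact/val_inj.
Qed.

Definition E1 : J := jelt 1 0 0 0 0 0.

(* In the coordinates of [jelt_coord], [sigma] negates [x_2] and [x_3]. *)
Definition sigma (X : J) : J :=
  jelt (jxi 0 X) (jxi 1 X) (jxi 2 X) (jx1 X) (- jx2 X) (- jx3 X).

(* The group law is composition of maps. *)
Definition F4 : set (J -> J) :=
  [set alpha | [/\ linear alpha, bijective alpha &
    forall X Y, alpha (jmul X Y) = jmul (alpha X) (alpha Y)]].

Definition F4_sigma : set (J -> J) :=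
  [set alpha | F4 alpha /\ sigma \o alpha = alpha \o sigma].

Definition F4_E1 : set (J -> J) := [set alpha | F4 alpha /\ alpha E1 = E1].

End JordanAlgebra.

Arguments F4 R _ : clear implicits.
Arguments F4_sigma R _ : clear implicits.
Arguments F4_E1 R _ : clear implicits.

HB.mixin Record isTopologicalGroup G of Topological G & Group G := {
  mulg_continuous : continuous (fun xy : G * G => (xy.1 * xy.2)%g);
  invg_continuous : continuous (fun x : G => (x^-1)%g)
}.
#[short(type="topologicalGroupType")]
HB.structure Definition TopologicalGroup :=
  {G of isTopologicalGroup G & Topological G & Group G}.

Definition SO (R : realType) (n : nat) : set 'M[R]_n :=
  [set A | A *m A^T = 1%:M /\ \det A = 1].
Arguments SO R n _ : clear implicits.

Section Covering.

(* [p] is a covering map of the subspace [D] of [B]: each point of [D] has a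
   relatively open neighbourhood [U `&` D] whose preimage is a disjoint union
   of open sets [V i], each mapped homeomorphically onto [U `&` D], with
   inverse [s i]. *)
Definition covering_map (E B : topologicalType) (D : set B) (p : E -> B) :=
  [/\ continuous p, range p = D &
    forall b, D b -> exists U : set B, [/\ open U, U b &
      exists (I : Type) (V : I -> set E) (s : I -> B -> E),
        [/\ forall i, open (V i), trivIset setT V,
            p @^-1` (U `&` D) = \bigcup_i V i &
            forall i, [/\ {within U `&` D, continuous (s i)},
              forall c, (U `&` D) c -> V i (s i c) /\ p (s i c) = c &
              forall x, V i x -> s i (p x) = x]]]].

Variable R : realType.

Definition path_connected (E : topologicalType) :=
  forall x y : E, exists g : R -> E,
    [/\ {within `[0, 1]%classic, continuous g}, g 0 = x & g 1 = y].

(* [H (s, t)]: [s] is the homotopy parameter, [t] the parameter of the loop;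
   the base point is fixed during the homotopy. *)
Definition simply_connected (E : topologicalType) :=
  path_connected E /\
  forall g : R -> E, {within `[0, 1]%classic, continuous g} -> g 0 = g 1 ->
    exists H : R * R -> E,
      [/\ {within `[0, 1]%classic `*` `[0, 1]%classic, continuous H},
          forall t, t \in `[0, 1] -> H (0, t) = g t /\ H (1, t) = g 0 &
          forall s, s \in `[0, 1] -> H (s, 0) = g 0 /\ H (s, 1) = g 0].

(* [(G, p)] is a universal double covering group of [SO n]; for [n >= 3] it is
   unique up to isomorphism, and is [Spin n]. *)
Definition universal_double_covering_SO (n : nat) (G : topologicalGroupType)
    (p : G -> 'M[R]_n) :=
  [/\ forall x y, p (x * y)%g = p x *m p y,
      covering_map (SO R n) p,
      simply_connected G &
      forall A, SO R n A -> (p @^-1` [set A] #= `I_2)%card].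

Definition is_Spin (n : nat) (G : topologicalGroupType) :=
  exists p : G -> 'M[R]_n, universal_double_covering_SO p.

End Covering.

(* [H] is a set of bijections of [T] forming a group under composition. *)
Definition isomorphic_to (T : Type) (H : set (T -> T)) (G : groupType) :=
  exists f : (T -> T) -> G,
    set_bij H setT f /\
    forall a b, H a -> H b -> f (a \o b) = (f a * f b)%g.

(* Main.v *)
Require Import Defs.
From HB Require Import structures.
From mathcomp Require Import all_boot all_order all_algebra.
From mathcomp Require Import all_classical all_reals all_analysis.
From mathcomp Require Import ring lra.

(** Relative to the idempotent E1, the Jordan algebra J splits as
    R E1 + R (E2 + E3) + V + S, where V is the 9-dimensional space of the
    trace-free elements of the Peirce 0-space (the parameters xi2 = - xi3
    and x1) and S is the 16-dimensional Peirce 1/2-space (the parameters x2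
    and x3). Two vectors multiply to their inner product times E2 + E3, and
    2 v o s defines a Clifford action of V on S, since v.(v.s) = |v|^2 s. The
    products S x S -> J are the transposes of this action, so all of J is
    described by [peirce_mul] in terms of two inner products and the Clifford
    action.

    The involution sigma is 1 on R E1 + R (E2 + E3) + V and -1 on S. An
    automorphism fixing E1 preserves the Peirce spaces and so commutes with
    sigma. Conversely, an automorphism commuting with sigma preserves S, so
    the image of E1 acts on S as multiplication by 1/2; this leaves only E1
    and E2 + E3, and E2 + E3 is excluded because E1 o X is always a multiple
    of E1 for X fixed by sigma ([F4_sigmaE]).

    An automorphism fixing E1 is a pair (A, h) with A orthogonal on V, h
    orthogonal on S and h (v.s) = (A v).(h s). The map [rot] to A has kernel
    {1, sigma} ([rot_ker]), because A = 1 makes h commute with the Clifford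
    action. It has image SO(9): the half turn about a unit vector u lifts to
    s |-> u.s, half turns and -1 generate O(9), and -1 has no lift because
    the product of the nine basis vectors acts on S as the scalar -1
    ([SO_rot], [rot_SO]).

    Now let p : G -> SO(9) be a universal double covering group. Instead of
    topologizing the stabilizer H of E1, p is lifted through [rot] locally:
    for A near 1 exactly one of the two lifts (A, h) has h close to 1, which
    is measured by the single matrix coefficient tau = <h v0, v0>. That A
    near 1 forces tau^2 near 1 holds because v0 spans the common fixed line
    of a few products of basis vectors, which gives 1 - tau^2 <= defect A with
    [defect] a polynomial vanishing at 1 ([tau_bound]). The resulting map
    from a neighbourhood of 1 in G to H is multiplicative where this makes
    sense, and G is simply connected, so it extends to a homomorphism
    phi : G -> H over SO(9) ([local_hom_extension], [lift_to_stabilizer]).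

    The kernels of p and of [rot] both have two elements, so phi is bijective
    once sigma is known to be in its image. The lifts of the half turns about
    two orthogonal vectors anticommute, that is, their commutator is sigma,
    whereas their images in SO(9) commute; hence sigma is phi of a commutator
    ([lift_bij]). *)

Set Implicit Arguments.
Unset Strict Implicit.
Unset Printing Implicit Defensive.
Import Order.TTheory GRing.Theory Num.Theory.
Import numFieldNormedType.Exports.
Local Open Scope classical_set_scope.
Local Open Scope ring_scope.

(** * Extending local homomorphisms on simply connected groups *)

Section Chain.
Variables (G H : groupType) (V : set G) (f : G -> H).
Hypothesis fM : forall x y, V x -> V y -> V (x * y)%g -> f (x * y)%g = (f x * f y)%g.
Local Open Scope group_scope.

Lemma local_mul_diff a b c : V (a^-1 * b) -> V (b^-1 * c) -> V (a^-1 * c) ->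
  f (a^-1 * b) * f (b^-1 * c) = f (a^-1 * c).
Proof.
have e : a^-1 * c = (a^-1 * b) * (b^-1 * c) by rewrite -mulgA mulVKg.
by move=> ab bc; rewrite e => ac; rewrite (fM ab bc ac).
Qed.

(** The increments of the grid u are transported by f and multiplied. For a
    fine enough grid on a path in G this is the end point of the lift of the
    path to H; no topology on H is involved. *)
Definition chain (u : nat -> G) (m : nat) : H :=
  \prod_(0 <= i < m) f ((u i)^-1 * u i.+1).

Lemma chainS u m : chain u m.+1 = chain u m * f ((u m)^-1 * u m.+1).
Proof. by rewrite /chain big_nat_recr. Qed.

Lemma chain0 u : chain u 0 = 1.
Proof. by rewrite /chain big_geq. Qed.

Lemma eq_chain u w m : (forall i, (i <= m)%N -> u i = w i) -> chain u m = chain w m.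
Proof.
by move=> uw; apply: eq_big_nat => i /andP[_ im]; rewrite !uw // ltnW.
Qed.

Lemma chainD u m n : chain u (m + n) = chain u m * chain (fun i => u (m + i)%N) n.
Proof.
elim: n => [|n IH]; first by rewrite addn0 chain0 mulg1.
by rewrite addnS !chainS IH mulgA addnS.
Qed.

Lemma chain_mull x u m : chain (fun i => x * u i) m = chain u m.
Proof.
by apply: eq_bigr => i _; rewrite invgM -mulgA mulKg.
Qed.

(** Each cell of the ladder is cut into two triangles by the diagonal from
    u i to w i.+1, and [local_mul_diff] makes both of them commute. *)
Lemma chain_ladder u w m :
    (forall i, (i <= m)%N -> V ((u i)^-1 * w i)) ->
    (forall i, (i < m)%N -> [/\ V ((u i)^-1 * u i.+1), V ((w i)^-1 * w i.+1) &
      V ((u i)^-1 * w i.+1)]) ->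
  chain u m * f ((u m)^-1 * w m) = f ((u 0)^-1 * w 0) * chain w m.
Proof.
elim: m => [|m IH] rung side; first by rewrite !chain0 mul1g mulg1.
have [Vu Vw Vd] := side m (ltnSn m).
rewrite !chainS -mulgA local_mul_diff //; last exact: rung.
rewrite -(@local_mul_diff _ (w m)) ?mulgA ?IH //; last by apply: rung.
- by move=> i im; apply: rung; apply: leqW.
- by move=> i im; apply: side; apply: leqW.
Qed.

Lemma chain_refine w m :
    (forall i, (i < m)%N -> [/\ V ((w i.*2)^-1 * w i.*2.+1),
       V ((w i.*2.+1)^-1 * w i.*2.+2) & V ((w i.*2)^-1 * w i.*2.+2)]) ->
  chain w m.*2 = chain (fun i => w i.*2) m.
Proof.
elim: m => [|m IH] side; first by rewrite !chain0.
have [Va Vb Vab] := side m (ltnSn m).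
rewrite doubleS !chainS IH; last by move=> i im; apply: side; apply: leqW.
by rewrite -mulgA local_mul_diff.
Qed.

End Chain.

(** A Lebesgue number for the unit square, stated on dyadic scales. *)
Lemma uniform_steps (R : realType) (G : topologicalGroupType) (V : set G)
    (K : R * R -> G) : nbhs (1%g : G) V -> continuous K ->
  exists N : nat, forall n, (N <= n)%N -> forall s t s' t' : R,
    0 <= s <= 1 -> 0 <= t <= 1 -> `|s - s'| <= (2 ^+ n)^-1 ->
    `|t - t'| <= (2 ^+ n)^-1 -> V ((K (s, t))^-1 * K (s', t'))%g.
Proof.
move=> V1 Kc.
pose sq : set (R * R) := `[0, 1]%classic `*` `[0, 1]%classic.
have /compact_near_coveringP cov : compact sq.
  by apply: compact_setX; exact: segment_compact.
pose P (n : nat) (a : R * R) := forall b : R * R, `|a.1 - b.1| <= (2 ^+ n)^-1 ->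
    `|a.2 - b.2| <= (2 ^+ n)^-1 -> V ((K a)^-1 * K b)%g.
have [N _ PN] : \forall n \near \oo, sq `<=` P n.
  apply: (cov _ _ P) => -[s0 t0] _.
  have Dc : (fun ab : (R * R) * (R * R) => (K ab.1)^-1 * K ab.2)%g
      @ ((s0, t0), (s0, t0)) --> (1%g : G).
    rewrite -(mulVg (K (s0, t0))).
    apply: (@cvg_comp _ _ _ (fun ab : (R * R) * (R * R) => ((K ab.1)^-1, K ab.2)%g)
      (fun xy : G * G => xy.1 * xy.2)%g _ (nbhs ((K (s0, t0))^-1%g, K (s0, t0)))).
      apply: cvg_pair; last first.
        by apply: (@cvg_comp _ _ _ snd K _ (nbhs (s0, t0))); [exact: cvg_snd|exact: Kc].
      apply: (@cvg_comp _ _ _ (fun ab : (R * R) * (R * R) => K ab.1)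
        (fun x : G => x^-1)%g _ (nbhs (K (s0, t0)))); last exact: invg_continuous.
      by apply: (@cvg_comp _ _ _ fst K _ (nbhs (s0, t0))); [exact: cvg_fst|exact: Kc].
    exact: (@mulg_continuous G ((K (s0, t0))^-1%g, K (s0, t0))).
  have /nbhs_ballP [e /= e0 eV] := Dc _ V1.
  have e20 : 0 < e / 2 by rewrite divr_gt0.
  exists (ball (s0, t0) (e / 2), [set n | (2 ^+ n)^-1 < e / 2]).
    split; first exact: nbhsx_ballx.
    have [n _ nP] := near_infty_natSinv_expn_lt (PosNum e20).
    by exists n => // m nm; have := nP m nm; rewrite /= div1r.
  move=> [[s t] n] [/= [/= bs bt] ne] [s' t'] /= ss tt.
  apply: (eV ((s, t), (s', t'))).
  have near_s (x0 x x' : R) : ball x0 (e / 2) x -> `|x - x'| <= (2 ^+ n)^-1 ->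
      ball x0 e x /\ ball x0 e x'.
    rewrite /ball /= => bx xx; split; first by lra.
    have -> : x0 - x' = (x0 - x) + (x - x') by ring.
    by apply: le_lt_trans (ler_normD _ _) _; lra.
  have [? ?] := near_s _ _ _ bs ss; have [? ?] := near_s _ _ _ bt tt.
  by split.
exists N => n Nn s t s' t' hs ht ss tt.
by apply: (PN n Nn (s, t)) => //; split; rewrite /= in_itv.
Qed.

Section Monodromy.
Variables (R : realType) (G : topologicalGroupType) (H : groupType).
Variables (V : set G) (f : G -> H).
Hypothesis simG : simply_connected R G.
Hypothesis V1 : nbhs (1%g : G) V.
Hypothesis fM : forall x y, V x -> V y -> V (x * y)%g -> f (x * y)%g = (f x * f y)%g.

Let f1 : f 1%g = 1%g.
Proof.
have V1' := nbhs_singleton V1.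
have := fM V1' V1'; rewrite mulg1 => /(_ V1') /(congr1 (fun z => (f 1)^-1 * z)%g).
by rewrite mulVg mulKg.
Qed.

Definition dyadic (n i : nat) : R := i%:R / 2 ^+ n.

Definition path_prod (g : R -> G) n : H := chain f (fun i => g (dyadic n i)) (2 ^ n).

Lemma dyadic0 n : dyadic n 0 = 0. Proof. by rewrite /dyadic mul0r. Qed.
Lemma dyadic_end n : dyadic n (2 ^ n) = 1.
Proof. by rewrite /dyadic natrX divff // expf_neq0. Qed.
Lemma dyadic_double n i : dyadic n.+1 i.*2 = dyadic n i.
Proof.
rewrite /dyadic -muln2 natrM exprS invfM mulrA.
by rewrite -[_ * 2%:R / _]mulrA mulfV // mulr1.
Qed.
Lemma dyadic_in n i : (i <= 2 ^ n)%N -> 0 <= dyadic n i <= 1.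
Proof.
move=> h; rewrite /dyadic divr_ge0 ?ler0n ?exprn_ge0 //=.
by rewrite ler_pdivrMr ?exprn_gt0 // mul1r -natrX ler_nat.
Qed.
Lemma dyadic_step n i : `|dyadic n i - dyadic n i.+1| = (2 ^+ n)^-1.
Proof.
rewrite /dyadic -mulrBl -(natr1 i) opprD addrA subrr add0r mulN1r normrN ger0_norm //.
Qed.
Lemma dyadic_step0 n i : `|dyadic n i - dyadic n i| <= (2 ^+ n)^-1.
Proof. by rewrite subrr normr0 invr_ge0 exprn_ge0. Qed.
Lemma dyadic_shift n i : dyadic n.+1 (2 ^ n + i) * 2 - 1 = dyadic n i.
Proof.
rewrite /dyadic natrD natrX exprS invfM; field.
by rewrite expf_neq0.
Qed.

(** Paths are functions on the whole line which are constant before 0 and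
    after 1. Two of them are then concatenated by the pointwise product
    g (2 t) g' (2 t - 1), whose continuity needs no gluing. *)
Definition clamped (g : R -> G) x :=
  [/\ continuous g, forall t, t <= 0 -> g t = 1%g & forall t, 1 <= t -> g t = x].

(** Analytic continuation of f: h is the value at x of the continuation along
    some path from 1 to x. [develops_total] and [develops_uniq] say that this
    relation is a function, and [develops_mul] that it is a homomorphism. *)
Definition develops x h := exists2 g : R -> G, clamped g x &
  exists N, forall n, (N <= n)%N -> path_prod g n = h.

Lemma path_steps (g : R -> G) : continuous g ->
  exists N : nat, forall n, (N <= n)%N -> forall t t' : R,
    0 <= t <= 1 -> `|t - t'| <= (2 ^+ n)^-1 -> V ((g t)^-1 * g t')%g.
Proof.
move=> gc.
have Kc : continuous (fun st : R * R => g st.2).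
  move=> st; apply: (@cvg_comp _ _ _ snd g _ (nbhs st.2)); [exact: cvg_snd|exact: gc].
have [N NP] := uniform_steps V1 Kc.
exists N => n Nn t t' tt h; apply: (NP n Nn 0 t 0 t') => //.
  by rewrite lexx ler01.
by rewrite subrr normr0 invr_ge0 exprn_ge0.
Qed.

(** Halving the steps does not change the product as soon as they are all in
    V, so it suffices to go from one dyadic scale to the next. *)
Lemma path_prod_stable (g : R -> G) : continuous g ->
  exists N, forall n, (N <= n)%N -> path_prod g n = path_prod g N.
Proof.
move=> gc; have [N NP] := path_steps gc; exists N; elim=> [|n IH].
  by rewrite leqn0 => /eqP ->.
rewrite leq_eqVlt => /orP[/eqP <- //|]; rewrite ltnS => Nn.
rewrite -(IH Nn) /path_prod expnS mul2n (chain_refine fM).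
  by apply: eq_chain => i _; rewrite dyadic_double.
move=> i im; have im2 : (i.*2.+1 < 2 ^ n.+1)%N.
  by rewrite expnS mul2n -doubleS leq_double.
have inv2 : (2 ^+ n.+1 : R)^-1 <= (2 ^+ n)^-1.
  by rewrite lef_pV2 ?posrE ?exprn_gt0 // ler_eXn2l // ltr1n.
have im1 := ltnW im2; have im0 := ltnW im1.
split.
- by apply: (NP n Nn); rewrite ?dyadic_in // dyadic_step.
- by apply: (NP n Nn); rewrite ?dyadic_in // dyadic_step.
- by apply: (NP n Nn); rewrite ?dyadic_in // -doubleS !dyadic_double dyadic_step.
Qed.

Definition clamp (t : R) : R := Num.max 0 (Num.min 1 t).
Lemma clamp_in t : 0 <= clamp t <= 1.
Proof. by rewrite /clamp le_max lexx /= ge_max ler01 ge_min lexx. Qed.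
Lemma clamp_id t : 0 <= t <= 1 -> clamp t = t.
Proof. by move=> /andP[t0 t1]; rewrite /clamp min_r // max_r. Qed.
Lemma clamp0 t : t <= 0 -> clamp t = 0.
Proof. by move=> t0; rewrite /clamp min_r ?max_l // (le_trans t0). Qed.
Lemma clamp1 t : 1 <= t -> clamp t = 1.
Proof. by move=> t0; rewrite /clamp min_l ?max_r. Qed.
Lemma clamp_continuous : continuous clamp.
Proof.
move=> t; apply: continuous_max; first exact: cvg_cst.
by apply: continuous_min; [exact: cvg_cst|exact: cvg_id].
Qed.

Lemma continuous_comp_within (S T : topologicalType) (A : set S) (c : T -> S) (g : S -> G) :
  continuous c -> (forall t, A (c t)) -> {within A, continuous g} ->
  continuous (g \o c).
Proof.
move=> cc cA /subspace_continuousP gA t.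
apply: (@cvg_comp _ _ _ c g _ (within A (nbhs (c t)))); last exact: gA.
move=> B nB; have := cc t _ nB.
change (nbhs t (c @^-1` [set y | A y -> B y]) -> nbhs t (c @^-1` B)).
by apply: filterS => y AB; exact: AB (cA y).
Qed.

Lemma develops_total x : exists h, develops x h.
Proof.
have [g [gc g0 g1]] := simG.1 1%g x.
have cc : continuous (g \o clamp).
  apply: (continuous_comp_within clamp_continuous _ gc) => t.
  by rewrite /= in_itv /= clamp_in.
have [N NP] := path_prod_stable cc.
exists (path_prod (g \o clamp) N), (g \o clamp); last by exists N.
by split=> // t h /=; [rewrite clamp0|rewrite clamp1].
Qed.

Lemma develops_mul x y h k : develops x h -> develops y k -> develops (x * y)%g (h * k)%g.
Proof.
move=> [g [gc g0 g1] [N gN]] [g' [gc' g0' g1'] [N' gN']].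
exists (fun t : R => (g (t * 2)%R * g' (t * 2 - 1)%R)%g).
  split.
  - move=> t.
    have c2 : {for t, continuous (fun t : R => t * 2)}.
      by apply: cvgM; [exact: cvg_id|exact: cvg_cst].
    apply: (@cvg_comp _ _ _ (fun t => (g (t * 2), g' (t * 2 - 1)))
      (fun xy : G * G => xy.1 * xy.2)%g _ (nbhs (g (t * 2), g' (t * 2 - 1)))).
      apply: cvg_pair.
        by apply: (@cvg_comp _ _ _ (fun t : R => t * 2) g _ (nbhs (t * 2))) => //; exact: gc.
      apply: (@cvg_comp _ _ _ (fun t : R => t * 2 - 1) g' _ (nbhs (t * 2 - 1))).
        by apply: cvgB; [exact: c2|exact: cvg_cst].
      exact: gc'.
    exact: (@mulg_continuous G (g (t * 2), g' (t * 2 - 1))).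
  - by move=> t t0; rewrite g0 ?g0' ?mulg1 //; lra.
  - by move=> t t0; rewrite g1 ?g1' //; lra.
exists (maxn N N').+1 => -[//|n]; rewrite ltnS geq_max => /andP[Nn N'n].
rewrite /path_prod expnS mul2n -addnn chainD; congr (_ * _)%g.
  rewrite -(gN n Nn); apply: eq_chain => i im.
  have -> : dyadic n.+1 i * 2 = dyadic n i.
    by rewrite -(dyadic_double n i) /dyadic -muln2 natrM mulrAC.
  have le1 : dyadic n i - 1 <= 0 by rewrite subr_le0; case/andP: (dyadic_in im).
  by rewrite (g0' _ le1) mulg1.
rewrite -(gN' n N'n) -[RHS](chain_mull f x); apply: eq_chain => i im.
have ge1 : 1 <= dyadic n.+1 (2 ^ n + i) * 2.
  by have /andP[] := dyadic_in im; have := dyadic_shift n i; lra.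
by rewrite dyadic_shift (g1 _ ge1).
Qed.

(** This is where simple connectedness enters: a null-homotopy of the loop is
    cut into a grid so fine that consecutive rows form ladders; hence the rows
    have equal products, and the last row is constant. *)
Lemma develops1 h : develops 1%g h -> h = 1%g.
Proof.
move=> [g [gc g0 g1] [N gN]].
have [||F [Fc Ft Fs]] := simG.2 g.
- exact: continuous_subspaceT.
- by rewrite g0 // g1.
rewrite g0 // in Ft Fs.
(* The homotopy is continuous only on the square; retracting the plane to
   the square gives a map that is continuous everywhere. *)
have [K [Kc KE]] : exists K : R * R -> G, continuous K /\
    forall s t, 0 <= s <= 1 -> 0 <= t <= 1 -> F (s, t) = K (s, t).
  pose c2 (st : R * R) : R * R := (clamp st.1, clamp st.2).
  exists (F \o c2); split; last first.
    by move=> s t hs ht; rewrite /= /c2 /= !clamp_id.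
  apply: (continuous_comp_within _ _ Fc).
    move=> st.
    have l1 : (fun st : R * R => clamp st.1) @ st --> clamp st.1.
      apply: (@cvg_comp _ _ _ fst clamp _ (nbhs st.1)); first exact: cvg_fst.
      exact: clamp_continuous.
    have l2 : (fun st : R * R => clamp st.2) @ st --> clamp st.2.
      apply: (@cvg_comp _ _ _ snd clamp _ (nbhs st.2)); first exact: cvg_snd.
      exact: clamp_continuous.
    exact: (cvg_pair l1 l2).
  by move=> st; split; rewrite /= in_itv /= clamp_in.
have [N' KV] := uniform_steps V1 Kc.
pose n := maxn N N'.
rewrite -(gN n (leq_maxl _ _)).
have := KV n (leq_maxr _ _); move: n => n {}KV.
pose row i := chain f (fun j => F (dyadic n i, dyadic n j)) (2 ^ n).
have cE i j : (i <= 2 ^ n)%N -> (j <= 2 ^ n)%N ->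
    F (dyadic n i, dyadic n j) = K (dyadic n i, dyadic n j).
  by move=> hi hj; apply: KE; apply: dyadic_in.
have rowS i : (i < 2 ^ n)%N -> row i = row i.+1.
  move=> im.
  have := @chain_ladder _ _ _ _ fM (fun j => F (dyadic n i, dyadic n j))
    (fun j => F (dyadic n i.+1, dyadic n j)) (2 ^ n).
  rewrite -/(row i) -/(row i.+1) dyadic0 dyadic_end.
  have I k : (k <= 2 ^ n)%N -> dyadic n k \in `[0, 1].
    by move=> kn; rewrite in_itv /= dyadic_in.
  have im' := ltnW im.
  rewrite !(Fs _ (I _ _)).1 // !(Fs _ (I _ _)).2 // invg1 mul1g f1 mulg1 mul1g.
  apply.
    move=> j jm; rewrite !cE //; apply: KV; rewrite ?dyadic_in //.
      by rewrite dyadic_step.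
    exact: dyadic_step0.
  move=> j jm; have jm' := ltnW jm; rewrite !cE //.
  by split; apply: KV; rewrite ?dyadic_in ?dyadic_step ?dyadic_step0.
have row0 i : (i <= 2 ^ n)%N -> row 0 = row i.
  by elim: i => [//|i IH im]; exact: etrans (IH (ltnW im)) (rowS i im).
have I01 k : (k <= 2 ^ n)%N -> dyadic n k \in `[0, 1].
  by move=> kn; rewrite in_itv /= dyadic_in.
have -> : path_prod g n = row 0.
  by apply: eq_chain => j jm; rewrite dyadic0 (Ft _ (I01 _ jm)).1.
rewrite (row0 _ (leqnn _)) /row dyadic_end.
rewrite (@eq_chain _ _ _ _ (fun=> 1%g)); last by move=> j jm; rewrite (Ft _ (I01 _ jm)).2.
by rewrite /chain big1 // => j _; rewrite invg1 mulg1 f1.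
Qed.

(** Two continuations to x are compared by appending the same continuation to
    x^-1 to both, which reduces to the loops of [develops1]. *)
Lemma develops_uniq x h k : develops x h -> develops x k -> h = k.
Proof.
move=> xh xk; have [l xl] := develops_total x^-1%g.
have hl := develops_mul xh xl; have kl := develops_mul xk xl.
rewrite mulgV in hl kl.
by apply: (mulIg l); rewrite (develops1 hl) (develops1 kl).
Qed.

(** The principle of monodromy. The second clause is the induction principle
    for phi: a multiplicative relation that holds between v and f v for all v
    in V holds between x and phi x for all x, because phi x is a product of
    values of f along a path to x. *)
Lemma local_hom_extension : exists phi : G -> H,
  (forall x y, phi (x * y)%g = (phi x * phi y)%g) /\
  forall Q : G -> H -> Prop, Q 1%g 1%g ->
    (forall x y h k, Q x h -> Q y k -> Q (x * y)%g (h * k)%g) ->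
    (forall v, V v -> Q v (f v)) -> forall x, Q x (phi x).
Proof.
have [phi phiP] := choice develops_total.
exists phi; split=> [x y|Q Q1 QM QV x].
  by apply: develops_uniq (phiP _) _; apply: develops_mul.
have [g [gc g0 g1] [N gN]] := phiP x.
have [N' gV] := path_steps gc.
pose n := maxn N N'.
rewrite -(gN n (leq_maxl _ _)); have := gV n (leq_maxr _ _); move: n => n {}gV.
suff key m : (m <= 2 ^ n)%N ->
    Q (g (dyadic n m)) (chain f (fun i => g (dyadic n i)) m).
  by have := key _ (leqnn _); rewrite dyadic_end g1.
elim: m => [|m IH] mn; first by rewrite chain0 dyadic0 g0.
rewrite chainS -(mulVKg (g (dyadic n m)) (g (dyadic n m.+1))).
apply: QM; first exact: IH (ltnW mn).
rewrite mulVKg; apply: QV; apply: gV; first exact: dyadic_in (ltnW mn).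
by rewrite dyadic_step.
Qed.

End Monodromy.

(** * Half turns generate the orthogonal group up to sign *)

Section HalfTurns.
Variables (R : realType) (n : nat).
Implicit Types u v w : 'cV[R]_n.

Definition vdot v w : R := \sum_i v i 0 * w i 0.

Lemma vdotC v w : vdot v w = vdot w v.
Proof. by apply: eq_bigr => i _; rewrite mulrC. Qed.
Lemma vdotDl u v w : vdot (u + v) w = vdot u w + vdot v w.
Proof. by rewrite -big_split; apply: eq_bigr => i _; rewrite !mxE mulrDl. Qed.
Lemma vdotZl t v w : vdot (t *: v) w = t * vdot v w.
Proof. by rewrite mulr_sumr; apply: eq_bigr => i _; rewrite !mxE mulrA. Qed.
Lemma vdotDr u v w : vdot w (u + v) = vdot w u + vdot w v.
Proof. by rewrite !(vdotC w) vdotDl. Qed.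
Lemma vdotZr t v w : vdot w (t *: v) = t * vdot w v.
Proof. by rewrite !(vdotC w) vdotZl. Qed.
Lemma vdot0l v : vdot 0 v = 0.
Proof. by rewrite -(scale0r (0 : 'cV[R]_n)) vdotZl mul0r. Qed.
Lemma vdot0r v : vdot v 0 = 0.
Proof. by rewrite vdotC vdot0l. Qed.

Lemma vdot_delta v i : vdot v (delta_mx i 0) = v i 0.
Proof.
rewrite /vdot (bigD1 i) //= big1 => [|j ji]; first by rewrite mxE !eqxx mulr1 addr0.
by rewrite mxE (negPf ji) mulr0.
Qed.

Lemma vdot_gt0 v : v != 0 -> 0 < vdot v v.
Proof.
move=> v0; rewrite lt_def sumr_ge0 ?andbT => [|i _]; last by rewrite -expr2 sqr_ge0.
apply: contraNneq v0 => s0; apply/eqP/colP => i; rewrite mxE.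
have /psumr_eq0P := s0 => /(_ (fun i _ => sqr_ge0 (v i 0)) i isT) /eqP.
by rewrite mulf_eq0 orbb => /eqP.
Qed.

Lemma eq_mulmx_col (A B : 'M[R]_n) : (forall v, A *m v = B *m v) -> A = B.
Proof.
move=> AB; apply/matrixP => i j; have := congr1 (fun x : 'cV_n => x i 0) (AB (delta_mx j 0)).
by rewrite -!colE !mxE.
Qed.

Lemma orth_vdotP (A : 'M[R]_n) :
  (forall v w, vdot (A *m v) (A *m w) = vdot v w) <-> A^T *m A = 1%:M.
Proof.
have e (v w : 'cV[R]_n) : (v^T *m w) 0 0 = vdot v w.
  by rewrite mxE; apply: eq_bigr => i _; rewrite mxE.
split=> [h|h v w]; last by rewrite -!e trmx_mul -mulmxA (mulmxA A^T) h mul1mx.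
apply/matrixP => i j; have := h (delta_mx i 0) (delta_mx j 0).
rewrite vdot_delta -!colE => hij; rewrite [RHS]mxE.
have -> : (A^T *m A) i j = vdot (col i A) (col j A).
  by rewrite mxE; apply: eq_bigr => k _; rewrite !mxE.
by rewrite hij mxE eqxx andbT eq_sym.
Qed.

(** The half turn about the line of u, that is, minus the reflection in the
    hyperplane orthogonal to u. In odd dimension it is in the special
    orthogonal group, unlike the reflection. *)
Definition half_turn u v : 'cV[R]_n := (2 * vdot u v) *: u - v.
Definition half_turn_mx u : 'M[R]_n := 2 *: (u *m u^T) - 1%:M.

Lemma half_turn_mxE u v : half_turn_mx u *m v = half_turn u v.
Proof.
rewrite /half_turn_mx /half_turn mulmxBl mul1mx -scalemxAl -mulmxA -scalerA; congr (_ *: _ - _).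
apply/colP => i; rewrite !mxE big_ord1 mulrC; congr (_ * _).
by rewrite mxE; apply: eq_bigr => j _; rewrite mxE.
Qed.

Lemma half_turnP u t v w : half_turn u (t *: v + w) = t *: half_turn u v + half_turn u w.
Proof. by rewrite -!half_turn_mxE mulmxDr -scalemxAr. Qed.

Lemma half_turnK u : vdot u u = 1 -> involutive (half_turn u).
Proof.
move=> u1 v; rewrite /half_turn vdotDr -(scaleN1r v) !vdotZr u1.
by apply/colP => i; rewrite !mxE; ring.
Qed.

Lemma half_turn_sym u v w : vdot (half_turn u v) w = vdot v (half_turn u w).
Proof.
rewrite /half_turn -(scaleN1r v) -(scaleN1r w) !vdotDr !vdotDl !vdotZr !vdotZl (vdotC u v).
by ring.
Qed.

Lemma half_turn_isometry u v w : vdot u u = 1 ->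
  vdot (half_turn u v) (half_turn u w) = vdot v w.
Proof. by move=> u1; rewrite half_turn_sym half_turnK. Qed.

(** The block matrix M is factored in two ways, as in the proof of Sylvester's
    identity det (1 + x y) = det (1 + y x). *)
Lemma det_half_turn_mx u : vdot u u = 1 -> \det (half_turn_mx u) = (-1) ^+ n.+1.
Proof.
move=> u1.
have uu : u^T *m u = 1%:M.
  apply/matrixP => i j; rewrite !ord1 !mxE -u1.
  by apply: eq_bigr => k _; rewrite mxE.
pose M := block_mx 1%:M u^T (2 *: u) 1%:M : 'M[R]_(1 + n).
have M1 : M = block_mx 1%:M 0 (2 *: u) 1%:M *m block_mx 1%:M u^T 0 (- half_turn_mx u).
  rewrite mulmx_block !(mul1mx, mul0mx, mulmx0, mulmx1, addr0) /M; congr block_mx.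
  by rewrite -scalemxAl /half_turn_mx opprB addrCA subrr addr0.
have M2 : M = block_mx (- 1)%:M u^T 0 1%:M *m block_mx 1%:M 0 (2 *: u) 1%:M.
  rewrite mulmx_block !(mul1mx, mul0mx, mulmx0, mulmx1, add0r) /M; congr block_mx.
  rewrite -scalemxAr uu; apply/matrixP => i j; rewrite !ord1 !mxE /=.
  by rewrite mulr1n; ring.
have : \det (- half_turn_mx u) = -1.
  have := congr1 determinant M1; rewrite M2 !det_mulmx !det_lblock !det_ublock !det1.
  by rewrite det_scalar1 !mulr1 !mul1r => <-.
rewrite -scaleN1r detZ => /(congr1 (fun x => (-1) ^+ n * x)).
by rewrite mulrA -exprMn mulrNN mulr1 expr1n mul1r exprS mulN1r mulrN1.
Qed.

(** Cartan-Dieudonne: if A fixes the basis vectors after e, the reflection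
    exchanging e and A e makes the product fix e as well, and it still fixes
    the later ones, which are orthogonal to both e and A e. *)
Lemma orthogonal_ind (P : 'M[R]_n -> Prop) :
    P 1%:M -> (forall A, P A -> P (- A)) ->
    (forall u A, vdot u u = 1 -> P A -> P (half_turn_mx u *m A)) ->
  forall A, A^T *m A = 1%:M -> P A.
Proof.
move=> P1 PN PH.
suff key m A : A^T *m A = 1%:M ->
    (forall j : 'I_n, (m <= j)%N -> A *m delta_mx j 0 = delta_mx j 0 :> 'cV_n) -> P A.
  by move=> A oA; apply: (key n A oA) => j; rewrite leqNgt ltn_ord.
elim: m A => [|m IH] A oA fixA.
  suff -> : A = 1%:M by [].
  apply/matrixP => i j; have := congr1 (fun x : 'cV_n => x i 0) (fixA j isT).
  by rewrite -colE !mxE andbT => ->.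
have [nm|mn] := leqP n m.
  by apply: IH oA _ => j mj; have := leq_trans nm mj; rewrite leqNgt ltn_ord.
pose i : 'I_n := Ordinal mn; pose e : 'cV[R]_n := delta_mx i 0.
have /orth_vdotP isoA := oA.
have fix_next (j : 'I_n) : (m <= j)%N -> j != i -> A *m delta_mx j 0 = delta_mx j 0 :> 'cV_n.
  move=> mj ji; apply: fixA; rewrite ltn_neqAle mj andbT.
  by apply: contraNneq ji => mj'; apply/eqP/val_inj.
have [Ae|Ae] := eqVneq (A *m e) e.
  apply: IH oA _ => j mj; have [->//|ji] := eqVneq j i; exact: fix_next.
pose d := A *m e - e; pose N := vdot d d.
have N0 : 0 < N by apply: vdot_gt0; rewrite subr_eq0.
have ee : vdot e e = 1 by rewrite vdot_delta mxE !eqxx.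
have dE x : vdot d x = vdot (A *m e) x - vdot e x.
  by rewrite /d -scaleN1r vdotDl vdotZl mulN1r.
have NE : N = 2 * vdot d (A *m e).
  rewrite /N {2}/d -scaleN1r vdotDr vdotZr !dE isoA ee (vdotC (A *m e)); ring.
pose u := (Num.sqrt N)^-1 *: d.
have NN : (Num.sqrt N)^-1 * (Num.sqrt N)^-1 = N^-1.
  by rewrite -invfM -expr2 sqr_sqrtr // ltW.
have u1 : vdot u u = 1.
  by rewrite /u vdotZl vdotZr mulrA NN mulVf // gt_eqF.
have hE x : half_turn u x = (2 * vdot d x / N) *: d - x.
  rewrite /half_turn /u vdotZl scalerA; congr (_ *: _ - _).
  rewrite -NN; ring.
have hh : half_turn_mx u *m half_turn_mx u = 1%:M.
  by apply: eq_mulmx_col => v; rewrite -mulmxA !half_turn_mxE half_turnK // mul1mx.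
suff PA' : P (- (half_turn_mx u *m A)).
  by have := PN _ (PH u _ u1 PA'); rewrite mulmxN opprK mulmxA hh mul1mx.
apply: IH => [|j mj].
  have vdotNN x y : vdot (- x) (- y) = vdot x y.
    by apply: eq_bigr => k _; rewrite !mxE mulrNN.
  apply/orth_vdotP => v w; rewrite !mulNmx vdotNN.
  by rewrite -!mulmxA !half_turn_mxE half_turn_isometry // isoA.
rewrite mulNmx -mulmxA half_turn_mxE; have [->|ji] := eqVneq j i.
  rewrite -/e hE -NE divff ?gt_eqF // scale1r /d.
  by rewrite opprB opprB addrCA subrr addr0.
rewrite (fix_next _ mj ji) hE dE -{1}(fix_next _ mj ji) isoA subrr mulr0 mul0r scale0r.
by rewrite sub0r opprK.
Qed.
End HalfTurns.

(** * The Jordan product in coordinates *)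

Ltac coords x := case: x => [[[[? ?] ?] ?] [[[? ?] ?] ?]].

(** Applying this lemma, rather than a congruence for pairs, exposes the
    eight real coordinates by reduction alone. *)
Lemma cayley_eq (R : realType) (x y : cayley R) :
  x.1.1.1.1 = y.1.1.1.1 -> x.1.1.1.2 = y.1.1.1.2 -> x.1.1.2 = y.1.1.2 -> x.1.2 = y.1.2 ->
  x.2.1.1.1 = y.2.1.1.1 -> x.2.1.1.2 = y.2.1.1.2 -> x.2.1.2 = y.2.1.2 -> x.2.2 = y.2.2 ->
  x = y.
Proof.
coords x; coords y => /=.
by do 8![move=> ->].
Qed.
Ltac octring := unfold cmul, cconj, qmul, qconj, creal; apply: cayley_eq; cbn; ring.
Ltac octfield := unfold cmul, cconj, qmul, qconj, creal; apply: cayley_eq; cbn; field.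
(* Without this, simplification expands every product of Cayley numbers into
   real coordinates. *)
Arguments cmul : simpl never.
Arguments qmul : simpl never.
Arguments cconj : simpl never.
Arguments qconj : simpl never.
Arguments creal : simpl never.

Section Coordinates.
Variable R : realType.
Local Notation C := (cayley R).
Local Notation J := (jordan R).

Definition cdot (x y : C) : R :=
  let: ((a0, a1, a2, a3), (a4, a5, a6, a7)) := x in
  let: ((b0, b1, b2, b3), (b4, b5, b6, b7)) := y in
  a0 * b0 + a1 * b1 + a2 * b2 + a3 * b3 + a4 * b4 + a5 * b5 + a6 * b6 + a7 * b7.

Lemma creD : {morph @cre R : x y / x + y}. Proof. by []. Qed.
Lemma creZ a (x : C) : cre (a *: x) = a * cre x. Proof. by []. Qed.
Lemma cre_creal (a : R) : cre (creal a) = a. Proof. by []. Qed.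

Lemma cmul_creall (a : R) (x : C) : cmul (creal a) x = a *: x.
Proof. by coords x; octring. Qed.

Lemma cmul_crealr (a : R) (x : C) : cmul x (creal a) = a *: x.
Proof. by coords x; octring. Qed.

Lemma cre_mulconjr (x y : C) : cre (cmul x (cconj y)) = cdot x y.
Proof. by coords x; coords y; rewrite /cmul /qmul /cconj /qconj; cbn; ring. Qed.

Lemma cre_mulconjl (x y : C) : cre (cmul (cconj x) y) = cdot x y.
Proof. by coords x; coords y; rewrite /cmul /qmul /cconj /qconj; cbn; ring. Qed.

Lemma cdotC (x y : C) : cdot x y = cdot y x.
Proof. by coords x; coords y; rewrite /cmul /qmul /cconj /qconj; cbn; ring. Qed.

Lemma cdotDl (x y z : C) : cdot (x + y) z = cdot x z + cdot y z.
Proof. by coords x; coords y; coords z; cbn; ring. Qed.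

Lemma cdotZl a (x y : C) : cdot (a *: x) y = a * cdot x y.
Proof. by coords x; coords y; rewrite /cmul /qmul /cconj /qconj; cbn; ring. Qed.

Lemma jmulE (a1 a2 a3 b1 b2 b3 : R) (x1 x2 x3 y1 y2 y3 : C) :
  jmul (jelt a1 a2 a3 x1 x2 x3) (jelt b1 b2 b3 y1 y2 y3) =
  jelt (a1 * b1 + cdot x2 y2 + cdot x3 y3) (a2 * b2 + cdot x3 y3 + cdot x1 y1)
    (a3 * b3 + cdot x1 y1 + cdot x2 y2)
    (2^-1 *: ((a2 + a3) *: y1 + (b2 + b3) *: x1 + cconj (cmul x2 y3 + cmul y2 x3)))
    (2^-1 *: ((a3 + a1) *: y2 + (b3 + b1) *: x2 + cconj (cmul x3 y1 + cmul y3 x1)))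
    (2^-1 *: ((a1 + a2) *: y3 + (b1 + b2) *: x3 + cconj (cmul x1 y2 + cmul y1 x2))).
Proof.
have h : (2 : R) != 0 by rewrite pnatr_eq0.
rewrite (jelt_coord (jmul _ _)).
congr jelt; rewrite /jxi /jx1 /jx2 /jx3 !mxE !big_ord_recl !big_ord0 !mxE /=.
- rewrite !(creD, creZ) !cmul_creall !creZ !cre_creal !cre_mulconjr !cre_mulconjl.
  rewrite -!(cdotC x2) -!(cdotC x3); by field.
- rewrite !(creD, creZ) !cmul_creall !creZ !cre_creal !cre_mulconjr !cre_mulconjl.
  rewrite -!(cdotC x1) -!(cdotC x3); by field.
- rewrite !(creD, creZ) !cmul_creall !creZ !cre_creal !cre_mulconjr !cre_mulconjl.
  rewrite -!(cdotC x2) -!(cdotC x1); by field.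
- congr (_ *: _); rewrite cconjD !cconjM !cmul_creall !cmul_crealr.
  move: (cmul (cconj x3) _) (cmul (cconj y3) _) => u w.
  by coords u; coords w; coords x1; coords y1; octring.
- congr (_ *: _); rewrite cconjD !cconjM !cmul_creall !cmul_crealr.
  move: (cmul (cconj x1) _) (cmul (cconj y1) _) => u w.
  by coords u; coords w; coords x2; coords y2; octring.
- congr (_ *: _); rewrite cconjD !cconjM !cmul_creall !cmul_crealr.
  move: (cmul (cconj x2) _) (cmul (cconj y2) _) => u w.
  by coords u; coords w; coords x3; coords y3; octring.
Qed.

Lemma jeltD (a1 a2 a3 b1 b2 b3 : R) (x1 x2 x3 y1 y2 y3 : C) :
  jelt a1 a2 a3 x1 x2 x3 + jelt b1 b2 b3 y1 y2 y3 =
  jelt (a1 + b1) (a2 + b2) (a3 + b3) (x1 + y1) (x2 + y2) (x3 + y3).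
Proof.
have crD (a b : R) : creal a + creal b = creal (a + b) by octring.
apply/val_inj/matrixP => i j; rewrite !mxE.
by case: i j => [[|[|[|//]]] ?] [[|[|[|//]]] ?] /=; rewrite -?cconjD ?crD.
Qed.

Lemma jeltZ (t a1 a2 a3 : R) (x1 x2 x3 : C) :
  t *: jelt a1 a2 a3 x1 x2 x3 =
  jelt (t * a1) (t * a2) (t * a3) (t *: x1) (t *: x2) (t *: x3).
Proof.
have crZ (a : R) : t *: creal a = creal (t * a) by octring.
apply/val_inj/matrixP => i j; rewrite !mxE.
by case: i j => [[|[|[|//]]] ?] [[|[|[|//]]] ?] /=; rewrite ?cconjZ ?crZ.
Qed.

Lemma jxiE (a1 a2 a3 : R) (x1 x2 x3 : C) :
  (jxi 0 (jelt a1 a2 a3 x1 x2 x3) = a1) * (jxi 1 (jelt a1 a2 a3 x1 x2 x3) = a2) *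
  (jxi 2 (jelt a1 a2 a3 x1 x2 x3) = a3) * (jx1 (jelt a1 a2 a3 x1 x2 x3) = x1) *
  (jx2 (jelt a1 a2 a3 x1 x2 x3) = x2) * (jx3 (jelt a1 a2 a3 x1 x2 x3) = x3).
Proof. by rewrite /jxi /jx1 /jx2 /jx3 !mxE. Qed.

Lemma jmulC (X Y : J) : jmul X Y = jmul Y X.
Proof. by apply/val_inj; rewrite /= addrC. Qed.

Lemma cmulDl (x y z : C) : cmul (x + y) z = cmul x z + cmul y z.
Proof. by coords x; coords y; coords z; octring. Qed.
Lemma cmulDr (x y z : C) : cmul z (x + y) = cmul z x + cmul z y.
Proof. by coords x; coords y; coords z; octring. Qed.
Lemma cmulZl t (x y : C) : cmul (t *: x) y = t *: cmul x y.
Proof. by coords x; coords y; octring. Qed.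
Lemma cmulZr t (x y : C) : cmul x (t *: y) = t *: cmul x y.
Proof. by coords x; coords y; octring. Qed.

End Coordinates.

(** * The Peirce decomposition and the Clifford action *)

(* Ordinals in constructor form, on which functions of the index compute. *)
Local Notation "k %:I9" := (@Ordinal 9 k%N isT) (at level 2, format "k %:I9").

Lemma eqN_eq0 (R : realType) (W : lmodType R) (x : W) : - x = x -> x = 0.
Proof.
move=> xN; apply: (scalerI (_ : 2 != 0 :> R)); first by rewrite pnatr_eq0.
by rewrite scaler0 scaler_nat mulr2n -{1}xN addNr.
Qed.

Section Peirce.
Variable R : realType.
Local Notation C := (cayley R).
Local Notation J := (jordan R).
Local Notation S := (cayley R * cayley R)%type.
Local Notation V := 'cV[R]_9.

(** Coordinate 0 of a vector is (xi2 - xi3) / 2; the other eight are those of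
    the Cayley number x1. *)
Definition vec_cayley (v : V) : C :=
  ((v 1%:I9 0, v 2%:I9 0, v 3%:I9 0, v 4%:I9 0), (v 5%:I9 0, v 6%:I9 0, v 7%:I9 0, v 8%:I9 0)).

Lemma sum9 (F : 'I_9 -> R) : \sum_i F i = F 0%:I9 + F 1%:I9 + F 2%:I9 + F 3%:I9 + F 4%:I9
  + F 5%:I9 + F 6%:I9 + F 7%:I9 + F 8%:I9.
Proof.
rewrite !big_ord_recr big_ord0 /= add0r.
by congr (_ + _ + _ + _ + _ + _ + _ + _ + _); congr F; apply: val_inj.
Qed.

Lemma vdotE v w : vdot v w = v 0%:I9 0 * w 0%:I9 0 + cdot (vec_cayley v) (vec_cayley w).
Proof. by rewrite /vdot sum9 /cdot /=; ring. Qed.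

Definition sdot (s s' : S) : R := cdot s.1 s'.1 + cdot s.2 s'.2.

(** Twice the Jordan product of the vector v with the element of the Peirce
    1/2-space whose coordinates x2, x3 are s.1, s.2 ([of_vec_of_spinor]). *)
Definition clifford (v : V) (s : S) : S :=
  (cconj (cmul s.2 (vec_cayley v)) - v 0%:I9 0 *: s.1,
   v 0%:I9 0 *: s.2 + cconj (cmul (vec_cayley v) s.1)).

(** Up to the factor 1/2, the vector part of the product of two spinors; it is
    defined as the transpose of the Clifford action ([spinor_sq_dot]). *)
Definition spinor_sq (s s' : S) : V := \col_i sdot (clifford (delta_mx i 0) s) s'.

(** The element a E1 + b (E2 + E3) + v + s. *)
Definition peirce (a b : R) (v : V) (s : S) : J :=
  jelt a (b + v 0%:I9 0) (b - v 0%:I9 0) (vec_cayley v) s.1 s.2.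

Lemma vec_cayleyD v w : vec_cayley (v + w) = vec_cayley v + vec_cayley w.
Proof. by rewrite /vec_cayley !mxE. Qed.
Lemma vec_cayleyZ t v : vec_cayley (t *: v) = t *: vec_cayley v.
Proof. by rewrite /vec_cayley !mxE. Qed.

Lemma peirceD a b v s a' b' v' s' :
  peirce a b v s + peirce a' b' v' s' = peirce (a + a') (b + b') (v + v') (s + s').
Proof. by rewrite /peirce jeltD vec_cayleyD !mxE; congr jelt; ring. Qed.
Lemma peirceZ t a b v s : t *: peirce a b v s = peirce (t * a) (t * b) (t *: v) (t *: s).
Proof. by rewrite /peirce jeltZ vec_cayleyZ !mxE; congr jelt; ring. Qed.

Definition vec_of (t : R) (x : C) : V := \col_i
  let: ((x0, x1, x2, x3), (x4, x5, x6, x7)) := x in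
  nth 0 [:: t; x0; x1; x2; x3; x4; x5; x6; x7] i.

Lemma vec_ofK t x : (vec_of t x 0%:I9 0 = t) * (vec_cayley (vec_of t x) = x).
Proof. by coords x; rewrite /vec_cayley /vec_of !mxE. Qed.

Lemma vec_ofE (v : V) t x : v 0%:I9 0 = t -> vec_cayley v = x -> v = vec_of t x.
Proof.
move=> <- <-; apply/colP => i; rewrite mxE /vec_cayley.
by case: i => [[|[|[|[|[|[|[|[|[|//]]]]]]]]] ?]; rewrite /=; congr (v _ _); apply: val_inj.
Qed.

Definition coefE1 (X : J) : R := jxi 0 X.
Definition coefE23 (X : J) : R := 2^-1 * (jxi 1 X + jxi 2 X).
Definition vec_part (X : J) : V := vec_of (2^-1 * (jxi 1 X - jxi 2 X)) (jx1 X).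
Definition spin_part (X : J) : S := (jx2 X, jx3 X).

Lemma peirce_coord X : X = peirce (coefE1 X) (coefE23 X) (vec_part X) (spin_part X).
Proof.
rewrite {1}(jelt_coord X) /peirce /coefE23 /vec_part !vec_ofK; congr jelt; by field.
Qed.

Lemma peirceK a b v s : [/\ coefE1 (peirce a b v s) = a, coefE23 (peirce a b v s) = b,
  vec_part (peirce a b v s) = v & spin_part (peirce a b v s) = s].
Proof.
rewrite /coefE1 /coefE23 /vec_part /spin_part /peirce !jxiE; split=> //; first by field.
  by symmetry; apply: vec_ofE => //; field.
by case: s.
Qed.

Lemma spinor_sqE s s' : spinor_sq s s' = vec_of (cdot s.2 s'.2 - cdot s.1 s'.1)
   (cconj (cmul s.1 s'.2 + cmul s'.1 s.2)).
Proof.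
case: s s' => [y z] [y' z'].
apply/colP => i; rewrite !mxE /sdot /clifford /vec_cayley !mxE !eqE /=.
coords y; coords z; coords y'; coords z'.
case: i => [[|[|[|[|[|[|[|[|[|//]]]]]]]]] ?]; rewrite /= ?mulr1n ?mulr0n;
  rewrite /cmul /cconj /qmul /qconj; cbn; ring.
Qed.

(** The multiplication table of J in the Peirce decomposition, from which all
    properties of automorphisms are derived. *)
Lemma peirce_mul a b v s a' b' v' s' : jmul (peirce a b v s) (peirce a' b' v' s') =
  peirce (a * a' + sdot s s') (b * b' + vdot v v' + 2^-1 * sdot s s')
     (b *: v' + b' *: v + 2^-1 *: spinor_sq s s')
     (2^-1 *: ((a + b) *: s' + (a' + b') *: s + clifford v s' + clifford v' s)).
Proof.
rewrite /peirce jmulE spinor_sqE vdotE !vec_cayleyD !vec_cayleyZ !mxE !vec_ofK /sdot /clifford.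
case: s s' => [y z] [y' z'] /=.
move: (v 0%:I9 0) (v' 0%:I9 0) (vec_cayley v) (vec_cayley v') => t t' x x'.
congr jelt.
- by rewrite addrA.
- by field.
- by field.
- rewrite scalerDr; congr (_ + _).
  by coords x; coords x'; octfield.
- congr (_ *: _); rewrite !cconjD.
  move: (cconj (cmul z x')) (cconj (cmul z' x)) => u w.
  by coords u; coords w; coords y; coords y'; octring.
- congr (_ *: _); rewrite !cconjD.
  move: (cconj (cmul x y')) (cconj (cmul x' y)) => u w.
  by coords u; coords w; coords z; coords z'; octring.
Qed.

Lemma sdotC s s' : sdot s s' = sdot s' s.
Proof. by rewrite /sdot cdotC [X in _ + X]cdotC. Qed.
Lemma sdotDl s s' r : sdot (s + s') r = sdot s r + sdot s' r.
Proof.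
rewrite /sdot; change (s + s').1 with (s.1 + s'.1); change (s + s').2 with (s.2 + s'.2).
by rewrite !cdotDl addrACA.
Qed.
Lemma sdotZl t s r : sdot (t *: s) r = t * sdot s r.
Proof.
rewrite /sdot; change (t *: s).1 with (t *: s.1); change (t *: s).2 with (t *: s.2).
by rewrite !cdotZl mulrDr.
Qed.
Lemma sdotDr s s' r : sdot r (s + s') = sdot r s + sdot r s'.
Proof. by rewrite !(sdotC r) sdotDl. Qed.
Lemma sdotZr t s r : sdot r (t *: s) = t * sdot r s.
Proof. by rewrite !(sdotC r) sdotZl. Qed.

Lemma cliffordDl v w s : clifford (v + w) s = clifford v s + clifford w s.
Proof.
case: s => y z.
rewrite /clifford vec_cayleyD !mxE /= !(cmulDl, cmulDr) !cconjD !scalerDl opprD.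
by congr (_, _); rewrite addrACA.
Qed.
Lemma cliffordZl t v s : clifford (t *: v) s = t *: clifford v s.
Proof.
case: s => y z; rewrite /clifford vec_cayleyZ !mxE /= !(cmulZl, cmulZr) !cconjZ.
by congr (_, _); rewrite /= ?scalerBr ?scalerDr scalerA.
Qed.
Lemma cliffordDr v s r : clifford v (s + r) = clifford v s + clifford v r.
Proof.
rewrite /clifford /= !(cmulDl, cmulDr) !cconjD !scalerDr opprD.
by congr (_, _); rewrite addrACA.
Qed.
Lemma cliffordZr t v s : clifford v (t *: s) = t *: clifford v s.
Proof.
rewrite /clifford /= !(cmulZl, cmulZr) !cconjZ.
by congr (_, _); rewrite /= ?scalerBr ?scalerDr !scalerA mulrC.
Qed.

(** The Clifford relation. It rests on the alternative law in the form
    conj x (x y) = |x|^2 y. *)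
Lemma clifford_sqr v s : clifford v (clifford v s) = vdot v v *: s.
Proof.
rewrite vdotE /clifford; move: (v 0%:I9 0) (vec_cayley v) => t x; case: s => [y z] /=.
by congr (_, _); coords x; coords y; coords z; octring.
Qed.

Lemma clifford_anti v w s :
  clifford v (clifford w s) + clifford w (clifford v s) = (2 * vdot v w) *: s.
Proof.
have := clifford_sqr (v + w) s.
rewrite !(cliffordDl, cliffordDr) !(vdotDl, vdotDr) (vdotC w v) !clifford_sqr !scalerDl.
rewrite -!addrA => /addrI; rewrite !addrA => /addIr ->.
by rewrite -scalerDl mulr2n mulrDl mul1r.
Qed.

Lemma clifford_sym v s s' : sdot (clifford v s) s' = sdot s (clifford v s').
Proof.
rewrite /clifford /sdot; move: (v 0%:I9 0) (vec_cayley v) => t x; case: s s' => [y z] [y' z'] /=.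
coords x; coords y; coords z; coords y'; coords z'.
rewrite /cmul /cconj /qmul /qconj; cbn; ring.
Qed.

Lemma spinor_sq_dot v s s' : vdot (spinor_sq s s') v = sdot (clifford v s) s'.
Proof.
rewrite spinor_sqE vdotE !vec_ofK /sdot /clifford; move: (v 0%:I9 0) (vec_cayley v) => t x.
case: s s' => [y z] [y' z'] /=.
coords x; coords y; coords z; coords y'; coords z'.
rewrite /cmul /cconj /qmul /qconj; cbn; ring.
Qed.

End Peirce.

(** * Half turns lift to automorphisms fixing E1 *)

Section HalfTurnLift.
Variable R : realType.
Local Notation C := (cayley R).
Local Notation J := (jordan R).
Local Notation S := (cayley R * cayley R)%type.
Local Notation V := 'cV[R]_9.

Lemma peirce_inj a b (v : V) (s : S) a' b' v' s' : peirce a b v s = peirce a' b' v' s' ->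
  [/\ a = a', b = b', v = v' & s = s'].
Proof.
move=> e; have [h1 h2 h3 h4] := peirceK a b v s; have [h1' h2' h3' h4'] := peirceK a' b' v' s'.
by split; [rewrite -h1 e|rewrite -h2 e|rewrite -h3 e|rewrite -h4 e].
Qed.

Lemma E1_peirce : E1 R = peirce 1 0 0 0.
Proof. by rewrite /E1 /peirce /vec_cayley !mxE addr0 subr0. Qed.

Lemma clifford0l (s : S) : clifford 0 s = 0.
Proof. by rewrite -(scale0r (0 : V)) cliffordZl scale0r. Qed.
Lemma clifford0r (v : V) : clifford v (0 : S) = 0.
Proof. by have := cliffordZr 0 v (0 : S); rewrite !scale0r. Qed.
Lemma sdot0l (s : S) : sdot 0 s = 0.
Proof. by rewrite -(scale0r (0 : S)) sdotZl mul0r. Qed.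
Lemma spinor_sq0l (s : S) : spinor_sq 0 s = 0.
Proof. by apply/colP => i; rewrite !mxE clifford0r sdot0l. Qed.
Variable u : V.

(** This is X |-> 2 w o (w o X) - X for the element w = E1 + u, whose square is
    the unit when u is a unit vector. *)
Definition half_turn_lift (X : J) : J :=
  peirce (coefE1 X) (coefE23 X) (half_turn u (vec_part X)) (clifford u (spin_part X)).

Lemma half_turn_lift_peirce a b v s :
  half_turn_lift (peirce a b v s) = peirce a b (half_turn u v) (clifford u s).
Proof. by rewrite /half_turn_lift; have [-> -> -> ->] := peirceK a b v s. Qed.

Lemma half_turn_lift_linear : linear half_turn_lift.
Proof.
move=> t X Y; rewrite (peirce_coord X) (peirce_coord Y) peirceZ peirceD.
rewrite !half_turn_lift_peirce peirceZ peirceD.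
by rewrite half_turnP cliffordDr cliffordZr.
Qed.

Hypothesis u1 : vdot u u = 1.

Lemma cliffordK s : clifford u (clifford u s) = s.
Proof. by rewrite clifford_sqr u1 scale1r. Qed.

Lemma half_turn_liftK : involutive half_turn_lift.
Proof.
by move=> X; rewrite (peirce_coord X) !half_turn_lift_peirce (half_turnK u1) cliffordK.
Qed.

(** Conjugation by u in the Clifford algebra is the half turn about u. *)
Lemma clifford_half_turn v s :
  clifford (half_turn u v) (clifford u s) = clifford u (clifford v s).
Proof.
rewrite /half_turn -(scaleN1r v) cliffordDl !cliffordZl cliffordK vdotC -clifford_anti scaleN1r.
by rewrite addrC addKr.
Qed.

Lemma spinor_sq_half_turn s s' :
  spinor_sq (clifford u s) (clifford u s') = half_turn u (spinor_sq s s').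
Proof.
apply/colP => i; rewrite -[RHS]vdot_delta half_turn_sym spinor_sq_dot mxE.
by rewrite -clifford_sym -{1}(half_turnK u1 (delta_mx i 0)) clifford_half_turn cliffordK.
Qed.

(** By the multiplication table this reduces to the equivariance of the inner
    products, of the Clifford action and of its transpose. *)
Lemma half_turn_lift_mul X Y :
  half_turn_lift (jmul X Y) = jmul (half_turn_lift X) (half_turn_lift Y).
Proof.
rewrite (peirce_coord X) (peirce_coord Y) !half_turn_lift_peirce !peirce_mul !half_turn_lift_peirce.
move: (coefE1 X) (coefE23 X) (vec_part X) (spin_part X) => a b v s.
move: (coefE1 Y) (coefE23 Y) (vec_part Y) (spin_part Y) => a' b' v' s'.
have rD : {morph half_turn u : x y / x + y}.
  by move=> x y; have := half_turnP u 1 x y; rewrite !scale1r.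
have r0 : half_turn u 0 = 0 by rewrite /half_turn vdot0r mulr0 scale0r subrr.
have rZ t : {morph half_turn u : x / t *: x}.
  by move=> x; have := half_turnP u t x 0; rewrite !addr0 r0 addr0.
rewrite half_turn_isometry // clifford_sym cliffordK spinor_sq_half_turn !clifford_half_turn.
by rewrite !rD !rZ cliffordZr !cliffordDr !cliffordZr.
Qed.

Lemma half_turn_lift_F4_E1 : F4_E1 R half_turn_lift.
Proof.
split; last first.
  by rewrite E1_peirce half_turn_lift_peirce clifford0r /half_turn vdot0r mulr0 scale0r subrr.
split; [exact: half_turn_lift_linear|exact: inv_bij half_turn_liftK|exact: half_turn_lift_mul].
Qed.

End HalfTurnLift.

(** * Automorphisms fixing E1 act on vectors and spinors *)

Section Stabilizer.
Variable R : realType.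
Local Notation C := (cayley R).
Local Notation J := (jordan R).
Local Notation S := (cayley R * cayley R)%type.
Local Notation V := 'cV[R]_9.

Definition of_vec (v : V) : J := peirce 0 0 v 0.
Definition of_spinor (s : S) : J := peirce 0 0 0 s.

Definition rot (al : J -> J) : 'M[R]_9 :=
  \matrix_(i, j) vec_part (al (of_vec (delta_mx j 0))) i 0.
Definition spin (al : J -> J) (s : S) : S := spin_part (al (of_spinor s)).

Lemma of_vecP t v w : of_vec (t *: v + w) = t *: of_vec v + of_vec w.
Proof. by rewrite /of_vec peirceZ peirceD !mulr0 !scaler0 !addr0. Qed.

Lemma of_vec_mul v w : jmul (of_vec v) (of_vec w) = peirce 0 (vdot v w) 0 0.
Proof.
rewrite /of_vec peirce_mul !(sdot0l, spinor_sq0l, clifford0r, scale0r, scaler0, mulr0, mul0r).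
by rewrite !(addr0, add0r, scaler0).
Qed.

Lemma of_vec_of_spinor v s : jmul (of_vec v) (of_spinor s) = of_spinor (2^-1 *: clifford v s).
Proof.
rewrite peirce_mul !(sdot0l, spinor_sq0l, vdot0r, clifford0r, scale0r, scaler0, mulr0, mul0r).
by rewrite !(addr0, add0r, scaler0, scale0r).
Qed.

Lemma of_spinor_mul s s' : jmul (of_spinor s) (of_spinor s') =
  peirce (sdot s s') (2^-1 * sdot s s') (2^-1 *: spinor_sq s s') 0.
Proof.
rewrite peirce_mul !(vdot0r, clifford0l, scale0r, scaler0, mulr0, mul0r).
by rewrite !(addr0, add0r, scaler0, scale0r).
Qed.

Lemma E1_mul a b v s : jmul (E1 R) (peirce a b v s) = peirce a 0 0 (2^-1 *: s).
Proof.
rewrite E1_peirce peirce_mul.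
rewrite !(sdot0l, spinor_sq0l, vdot0l, clifford0l, clifford0r, scale0r, scaler0).
by rewrite !(addr0, add0r, scaler0, scale0r, mul0r, mul1r, scale1r, mulr0).
Qed.

Lemma jmul1 (X : J) : jmul (peirce 1 1 0 0) X = X.
Proof.
rewrite {2}(peirce_coord X) {1}(peirce_coord X) peirce_mul.
rewrite !(sdot0l, spinor_sq0l, vdot0l, clifford0l, clifford0r, scale0r, scaler0).
rewrite !(addr0, add0r, scaler0, mul1r, mulr0, scale1r) scalerA mulrDr mulr1.
by have -> : 2^-1 + 2^-1 = 1 :> R by [field]; rewrite scale1r.
Qed.

Variable al : J -> J.
Hypothesis alF : F4_E1 R al.

Let al_lin : linear al. Proof. by case: alF => -[]. Qed.
Let al_bij : bijective al. Proof. by case: alF => -[]. Qed.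
Let al_mul X Y : al (jmul X Y) = jmul (al X) (al Y). Proof. by case: alF => -[]. Qed.
Let al_E1 : al (E1 R) = E1 R. Proof. by case: alF. Qed.

Let alD X Y : al (X + Y) = al X + al Y.
Proof. by have := al_lin 1 X Y; rewrite !scale1r. Qed.
Let al0 : al 0 = 0.
Proof. by apply: (@addrI _ (al 0)); rewrite -alD !addr0. Qed.
Let alZ t X : al (t *: X) = t *: al X.
Proof. by have := al_lin t X 0; rewrite !addr0 al0 addr0. Qed.

Lemma stab_unit : al (peirce 1 1 0 0) = peirce 1 1 0 0.
Proof.
have [bl blK alK] := al_bij.
have := al_mul (peirce 1 1 0 0) (bl (peirce 1 1 0 0)); rewrite jmul1 alK => {2}->.
by rewrite jmulC jmul1.
Qed.

Lemma stab_e b : al (peirce 0 b 0 0) = peirce 0 b 0 0.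
Proof.
have -> : peirce 0 b 0 0 = b *: peirce 1 1 (0 : V) (0 : S) + (- b) *: E1 R.
  by rewrite E1_peirce !peirceZ peirceD !scaler0 !addr0 !mulr1 !mulr0 addr0 subrr.
by rewrite alD !alZ stab_unit al_E1.
Qed.

(** Spinors are the elements with E1 o X = X / 2, an equation preserved by
    automorphisms fixing E1. *)
Lemma stab_spin s : al (of_spinor s) = of_spinor (spin al s).
Proof.
have := al_mul (E1 R) (of_spinor s); rewrite al_E1 E1_mul /spin.
have -> : peirce 0 0 0 (2^-1 *: s) = 2^-1 *: of_spinor s by rewrite peirceZ !mulr0 scaler0.
rewrite alZ [in RHS](peirce_coord (al (of_spinor s))).
rewrite [in LHS](peirce_coord (al (of_spinor s))) E1_mul peirceZ.
move=> /peirce_inj[a0 b0 v0 _].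
rewrite {1}(peirce_coord (al (of_spinor s))) /of_spinor.
have -> : coefE1 (al (of_spinor s)) = 0 by lra.
have -> : coefE23 (al (of_spinor s)) = 0 by lra.
suff -> : vec_part (al (of_spinor s)) = 0 by [].
by apply: (scalerI (_ : 2^-1 != 0 :> R)); rewrite ?scaler0 // invr_eq0 pnatr_eq0.
Qed.

(** E1 o X = 0 only gives that the image of v is b (E2 + E3) + w. Since v o v
    is a multiple of E2 + E3, so is the square of the image, hence b w = 0; if
    b were nonzero, v and b (E2 + E3) would have the same image. *)
Lemma stab_vec0 v : al (of_vec v) = of_vec (vec_part (al (of_vec v))).
Proof.
have := al_mul (E1 R) (of_vec v); rewrite al_E1 E1_mul scaler0.
have -> : peirce 0 0 0 0 = 0 :> J.
  by rewrite -(scale0r (peirce 0 0 (0 : V) (0 : S))) peirceZ !mulr0 !scaler0.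
rewrite al0 -(scale0r (peirce 0 0 (0 : V) (0 : S))) peirceZ !mulr0 !scaler0.
rewrite {1}(peirce_coord (al (of_vec v))) E1_mul => /peirce_inj[a0 _ _ s0].
have sE : spin_part (al (of_vec v)) = 0.
  by apply: (scalerI (_ : 2^-1 != 0 :> R)); rewrite ?scaler0 // invr_eq0 pnatr_eq0.
have E := peirce_coord (al (of_vec v)); rewrite sE -a0 in E.
set b := coefE23 _ in E; set w := vec_part _ in E *.
have [b0|b_neq0] := eqVneq b 0; first by rewrite E b0.
have := al_mul (of_vec v) (of_vec v); rewrite of_vec_mul stab_e E peirce_mul.
move=> /peirce_inj[_ _ w0 _].
have {}w0 : w = 0.
  move: w0; rewrite spinor_sq0l scaler0 addr0 -scalerDl => /eqP; rewrite eq_sym scaler_eq0.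
  by case/orP => /eqP // bb; case/eqP: b_neq0; lra.
have [bl blK _] := al_bij.
have : of_vec v = peirce 0 b 0 0 by apply: (can_inj blK); rewrite stab_e E w0.
by move=> /peirce_inj[_ b0]; case/eqP: b_neq0.
Qed.

Lemma stab_vec v : al (of_vec v) = of_vec (rot al *m v).
Proof.
rewrite stab_vec0; congr of_vec.
pose L v := vec_part (al (of_vec v)).
have LP t w w' : L (t *: w + w') = t *: L w + L w'.
  have jvK x : vec_part (of_vec x) = x by case: (peirceK 0 0 x (0 : S)).
  by rewrite /L of_vecP al_lin {1}(stab_vec0 w) {1}(stab_vec0 w') -of_vecP jvK.
have L0 : L 0 = 0.
  by have := LP (-1) 0 0; rewrite !scaler0 addr0 scaleN1r addNr.
have LD : {morph L : x y / x + y} by move=> x y; have := LP 1 x y; rewrite !scale1r.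
have LZ t x : L (t *: x) = t *: L x by have := LP t x 0; rewrite L0 !addr0.
rewrite -/(L v) [in LHS](matrix_sum_delta v) (big_morph L LD L0).
apply/colP => i; rewrite summxE mxE; apply: eq_bigr => j _.
by rewrite big_ord1 LZ !mxE mulrC.
Qed.

Lemma stab_peirce a b v s : al (peirce a b v s) = peirce a b (rot al *m v) (spin al s).
Proof.
have dec c d w r : peirce c d w r = c *: E1 R + (peirce 0 d 0 0 + (of_vec w + of_spinor r)).
  by rewrite E1_peirce peirceZ !peirceD !scaler0 mulr1 mulr0 !addr0 !add0r.
by rewrite dec !alD alZ al_E1 stab_e stab_vec stab_spin -dec.
Qed.

Lemma rot_dot v w : vdot (rot al *m v) (rot al *m w) = vdot v w.
Proof.
have := al_mul (of_vec v) (of_vec w); rewrite !stab_vec !of_vec_mul stab_e.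
by move=> /peirce_inj[].
Qed.

Lemma spinP t s s' : spin al (t *: s + s') = t *: spin al s + spin al s'.
Proof.
have eP r r' : of_spinor (t *: r + r') = t *: of_spinor r + of_spinor r'.
  by rewrite peirceZ peirceD !mulr0 !scaler0 !addr0.
have := al_lin t (of_spinor s) (of_spinor s'); rewrite -eP !stab_spin -eP.
by move=> /peirce_inj[].
Qed.

Lemma spin0 : spin al 0 = 0.
Proof. by have := spinP (-1) 0 0; rewrite !scaler0 !addr0 scaleN1r addNr. Qed.

Lemma spinZ t s : spin al (t *: s) = t *: spin al s.
Proof. by have := spinP t s 0; rewrite spin0 !addr0. Qed.

Lemma spinD s s' : spin al (s + s') = spin al s + spin al s'.
Proof. by have := spinP 1 s s'; rewrite !scale1r. Qed.

Lemma spinN s : spin al (- s) = - spin al s.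
Proof. by rewrite -scaleN1r spinZ scaleN1r. Qed.

Lemma spin_clifford v s : spin al (clifford v s) = clifford (rot al *m v) (spin al s).
Proof.
have := al_mul (of_vec v) (of_spinor s).
rewrite stab_vec stab_spin !of_vec_of_spinor stab_spin => /peirce_inj[_ _ _].
by rewrite spinZ => /scalerI; apply; rewrite invr_eq0 pnatr_eq0.
Qed.

Lemma spin_dot s s' : sdot (spin al s) (spin al s') = sdot s s'.
Proof.
have := al_mul (of_spinor s) (of_spinor s'); rewrite !stab_spin !of_spinor_mul stab_peirce.
by move=> /peirce_inj[].
Qed.

End Stabilizer.

(** * Kernel and image of the vector representation *)

Section VectorRepresentation.
Variable R : realType.
Local Notation C := (cayley R).
Local Notation J := (jordan R).
Local Notation S := (cayley R * cayley R)%type.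
Local Notation V := 'cV[R]_9.
Implicit Types al be : J -> J.

Lemma F4_E1_id : F4_E1 R id.
Proof. by split=> //; split=> //; exact: inv_bij. Qed.

Lemma F4_E1_comp al be : F4_E1 R al -> F4_E1 R be -> F4_E1 R (al \o be).
Proof.
move=> [[al_lin al_bij al_mul] al1] [[be_lin be_bij be_mul] be1]; split; last first.
  by rewrite /= be1.
split; last by move=> X Y; rewrite /= be_mul al_mul.
  by move=> t X Y; rewrite /= be_lin al_lin.
exact: bij_comp.
Qed.

Lemma F4_E1_inv al : F4_E1 R al ->
  exists be, [/\ F4_E1 R be, cancel al be & cancel be al].
Proof.
move=> [[al_lin [be alK beK] al_mul] al1]; exists be; split=> //.
have al_inj := can_inj alK.
split; last by apply: al_inj; rewrite beK al1.
split=> [t X Y||X Y]; first by apply: al_inj; rewrite al_lin !beK.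
  by exists al.
by apply: al_inj; rewrite al_mul !beK.
Qed.

Lemma of_vec_inj : injective (@of_vec R).
Proof. by move=> v w /peirce_inj[]. Qed.

Lemma rot_uniq al A : F4_E1 R al -> (forall v, al (of_vec v) = of_vec (A *m v)) -> rot al = A.
Proof.
move=> alF h; apply: eq_mulmx_col => v; apply: of_vec_inj.
by rewrite -h -stab_vec.
Qed.

Lemma rot_comp al be : F4_E1 R al -> F4_E1 R be -> rot (al \o be) = rot al *m rot be.
Proof.
move=> alF beF; apply: rot_uniq => [|v]; first exact: F4_E1_comp.
by rewrite /= !stab_vec // mulmxA.
Qed.

Lemma rot_id : rot id = 1%:M :> 'M[R]_9.
Proof. by apply: rot_uniq => [|v]; [exact: F4_E1_id|rewrite mul1mx]. Qed.

Lemma spin_comp al be s : F4_E1 R al -> F4_E1 R be ->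
  spin (al \o be) s = spin al (spin be s).
Proof. by move=> alF beF; rewrite /spin /= {1}(stab_spin beF). Qed.

Lemma rot_half_turn_lift (u : V) : vdot u u = 1 -> rot (half_turn_lift u) = half_turn_mx u.
Proof.
move=> u1; apply: rot_uniq => [|v]; first exact: half_turn_lift_F4_E1.
by rewrite /of_vec half_turn_lift_peirce clifford0r half_turn_mxE.
Qed.

Lemma rot_orth al : F4_E1 R al -> (rot al)^T *m rot al = 1%:M.
Proof. by move=> alF; apply/orth_vdotP; apply: rot_dot. Qed.

(** The action of the basis vectors on spinors, as signed permutations of
    coordinates ([clifford_delta]); composites of them evaluate by reduction
    without expanding any product of Cayley numbers. *)
Definition gamma (k : nat) (s : S) : S :=
  let: (((y0, y1, y2, y3), (y4, y5, y6, y7)),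
        ((z0, z1, z2, z3), (z4, z5, z6, z7))) := s in
  match k with
  | 0 => (((- y0, - y1, - y2, - y3), (- y4, - y5, - y6, - y7)),
         ((z0, z1, z2, z3), (z4, z5, z6, z7)))
  | 1 => (((z0, - z1, - z2, - z3), (- z4, - z5, - z6, - z7)),
         ((y0, - y1, - y2, - y3), (- y4, - y5, - y6, - y7)))
  | 2 => (((- z1, - z0, - z3, z2), (- z5, z4, z7, - z6)),
         ((- y1, - y0, y3, - y2), (y5, - y4, - y7, y6)))
  | 3 => (((- z2, z3, - z0, - z1), (- z6, - z7, z4, z5)),
         ((- y2, - y3, - y0, y1), (y6, y7, - y4, - y5)))
  | 4 => (((- z3, - z2, z1, - z0), (- z7, z6, - z5, z4)),
         ((- y3, y2, - y1, - y0), (y7, - y6, y5, - y4)))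
  | 5 => (((- z4, z5, z6, z7), (- z0, - z1, - z2, - z3)),
         ((- y4, - y5, - y6, - y7), (- y0, y1, y2, y3)))
  | 6 => (((- z5, - z4, z7, - z6), (z1, - z0, z3, - z2)),
         ((- y5, y4, - y7, y6), (- y1, - y0, - y3, y2)))
  | 7 => (((- z6, - z7, - z4, z5), (z2, - z3, - z0, z1)),
         ((- y6, y7, y4, - y5), (- y2, y3, - y0, - y1)))
  | _ => (((- z7, z6, - z5, - z4), (z3, z2, - z1, - z0)),
         ((- y7, - y6, y5, y4), (- y3, - y2, y1, - y0)))
  end.

Lemma clifford_delta (k : 'I_9) s : clifford (delta_mx k 0) s = gamma k s.
Proof.
case: s => [[[[[y0 y1] y2] y3] [[[y4 y5] y6] y7]] [[[[z0 z1] z2] z3] [[[z4 z5] z6] z7]]].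
by case: k => [[|[|[|[|[|[|[|[|[|//]]]]]]]]] ?];
  rewrite /clifford /vec_cayley !mxE !eqE /= ?mulr1n ?mulr0n; congr (_, _); octring.
Qed.

Definition clifford_word (A : 'M[R]_9) (ks : seq 'I_9) (s : S) : S :=
  foldr (fun k => clifford (col k A)) s ks.

Lemma spin_clifford_word al A ks s : F4_E1 R al ->
  spin al (clifford_word A ks s) = clifford_word (rot al *m A) ks (spin al s).
Proof.
move=> alF; elim: ks => //= k ks IH.
by rewrite spin_clifford // IH !colE mulmxA.
Qed.

Lemma clifford_wordN A ks s :
  clifford_word (- A) ks s = (-1) ^+ size ks *: clifford_word A ks s.
Proof.
elim: ks => [|k ks IH] /=; first by rewrite scale1r.
have -> : col k (- A) = -1 *: col k A by rewrite !colE mulNmx scaleN1r.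
by rewrite IH cliffordZl cliffordZr scalerA exprS.
Qed.

Lemma clifford_word1E ks s : clifford_word 1%:M ks s = foldr (fun k : 'I_9 => gamma k) s ks.
Proof. by elim: ks => //= k ks ->; rewrite colE mul1mx clifford_delta. Qed.

(** The volume element of an odd-dimensional Clifford algebra is central, so
    it is a scalar on an irreducible module. *)
Lemma clifford_volume s : clifford_word 1%:M
  [:: 0%:I9; 1%:I9; 2%:I9; 3%:I9; 4%:I9; 5%:I9; 6%:I9; 7%:I9; 8%:I9] s = - s.
Proof.
rewrite clifford_word1E.
case: s => [[[[[y0 y1] y2] y3] [[[y4 y5] y6] y7]] [[[[z0 z1] z2] z3] [[[z4 z5] z6] z7]]].
by rewrite /=; congr (_, _); octring.
Qed.

Definition spinor1 : S := (creal 1, 0).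
Local Notation v0 := spinor1.

Lemma sdot_v0 s : sdot s v0 = s.1.1.1.1.1.
Proof.
case: s => [[[[[y0 y1] y2] y3] [[[y4 y5] y6] y7]] [[[[z0 z1] z2] z3] [[[z4 z5] z6] z7]]].
by rewrite /sdot /v0 /creal; cbn; ring.
Qed.

Lemma sdot_v0v0 : sdot v0 v0 = 1.
Proof. by rewrite sdot_v0. Qed.

(** A lift of -1 would anticommute with the nine basis vectors, hence with
    their product; but that product is a nonzero scalar. *)
Lemma rot_neqN1 al : F4_E1 R al -> rot al <> - 1%:M.
Proof.
move=> alF rN.
have := clifford_volume (spin al v0).
set ks := (X in clifford_word _ X _) => volume.
have := spin_clifford_word 1%:M ks v0 alF.
rewrite clifford_volume rN mulmx1 clifford_wordN volume /= spinN //.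
rewrite -signr_odd /= expr1 scaleN1r opprK => /eqN_eq0 spin_v0.
have := spin_dot alF v0 v0; rewrite spin_v0 sdot0l sdot_v0v0 => /eqP.
by rewrite eq_sym oner_eq0.
Qed.

(** The vectors of a word correspond to 1 and to the three imaginary units of
    a line of the Fano plane. The product of such a word is diagonal with
    entries 1 and -1, and fixes [spinor1]; the three lines are chosen so that,
    on the coordinate x2, only the multiples of 1 are fixed by all three. *)
Definition fano_words : seq (seq 'I_9) :=
  [:: [:: 1%:I9; 2%:I9; 3%:I9; 4%:I9]; [:: 1%:I9; 2%:I9; 5%:I9; 6%:I9];
      [:: 1%:I9; 3%:I9; 5%:I9; 7%:I9]].

(** The operators of [fano_words], together with minus the first basis vector,
    have [spinor1] as their only common fixed vector up to scalars. The defect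
    of A measures how far the transforms of these operators by A are from
    fixing it. *)
Definition defect (A : 'M[R]_9) : R := 2^-1 * (1 + sdot (clifford_word A [:: 0%:I9] v0) v0 +
  \sum_(ks <- fano_words) (1 - sdot (clifford_word A ks v0) v0)).

(** Every basis spinor other than [spinor1] is negated by at least one of the
    four operators. *)
Lemma spinor_bound s : sdot s s - sdot s v0 ^+ 2 <=
  2^-1 * (sdot s s + sdot (clifford_word 1%:M [:: 0%:I9] s) s +
  \sum_(ks <- fano_words) (sdot s s - sdot (clifford_word 1%:M ks s) s)).
Proof.
rewrite !big_cons big_nil !clifford_word1E sdot_v0.
case: s => [[[[[y0 y1] y2] y3] [[[y4 y5] y6] y7]] [[[[z0 z1] z2] z3] [[[z4 z5] z6] z7]]].
rewrite /sdot; cbn.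
have sq (t : R) : 0 <= t * t by rewrite -expr2 sqr_ge0.
move: (sq y1) (sq y2) (sq y3) (sq y4) (sq y5) (sq y6) (sq y7).
move: (sq z0) (sq z1) (sq z2) (sq z3) (sq z4) (sq z5) (sq z6) (sq z7).
by clear sq; lra.
Qed.

Definition tau al : R := sdot (spin al v0) v0.

(** [spinor_bound] is applied to the image of [spinor1] under the inverse of
    al, and the operators are then carried back by al, which replaces the basis
    vectors by the columns of the matrix of al. *)
Lemma tau_bound al : F4_E1 R al -> 1 - tau al ^+ 2 <= defect (rot al).
Proof.
move=> alF; have [be [beF _ beK]] := F4_E1_inv alF.
have sK s : spin al (spin be s) = s.
  rewrite -spin_comp //; have -> : al \o be = id by apply/funext.
  by rewrite /spin; case: (peirceK 0 0 (0 : V) s).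
have := spinor_bound (spin be v0).
have e ks : sdot (clifford_word 1%:M ks (spin be v0)) (spin be v0) =
    sdot (clifford_word (rot al) ks v0) v0.
  by rewrite -(spin_dot alF) (spin_clifford_word _ _ _ alF) sK mulmx1.
have -> : sdot (spin be v0) v0 = tau al.
  by rewrite -(spin_dot alF) sK sdotC.
rewrite (spin_dot beF) sdot_v0v0 e.
by under eq_bigr do rewrite e.
Qed.

Lemma cdot_ge0 (x : C) : 0 <= cdot x x.
Proof. by coords x; rewrite /= !addr_ge0 // -expr2 sqr_ge0. Qed.

Lemma cdot_le0 (x : C) : cdot x x <= 0 -> x = 0.
Proof.
case: x => [[[[a0 a1] a2] a3] [[[a4 a5] a6] a7]]; rewrite /cdot => h.
have sq (t : R) : 0 <= t * t by rewrite -expr2 sqr_ge0.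
have z (t : R) : t * t <= 0 -> t = 0.
  by move=> t0; apply/eqP; rewrite -[t == 0]orbb -mulf_eq0 eq_le sq t0.
move: (sq a0) (sq a1) (sq a2) (sq a3) (sq a4) (sq a5) (sq a6) (sq a7) => *.
by apply: cayley_eq => /=; apply: z; lra.
Qed.

Lemma sdot_le0 (s : S) : sdot s s <= 0 -> s = 0.
Proof.
case: s => [y z]; rewrite /sdot /= => h; have := cdot_ge0 y; have := cdot_ge0 z => z0 y0.
by congr (_, _); apply: cdot_le0; lra.
Qed.

Lemma defect1 : defect 1%:M = 0.
Proof.
rewrite /defect !big_cons big_nil !clifford_word1E !sdot_v0 /=; cbn; ring.
Qed.

(** The Clifford action generates all spinors from [spinor1], so an operator
    commuting with the action is determined by the image of [spinor1]. *)
Lemma spinor_gen y z : (y, z) =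
  clifford (vec_of 0 (creal 1)) (clifford (vec_of 0 y) v0) + clifford (vec_of 0 (cconj z)) v0 :> S.
Proof.
rewrite /clifford !vec_ofK /v0; congr (_, _); coords y; coords z; octring.
Qed.

Lemma sigma_peirce a b (v : V) (s : S) : @sigma R (peirce a b v s) = peirce a b v (- s).
Proof. by rewrite /sigma !jxiE. Qed.

Lemma rot_ker al : F4_E1 R al -> rot al = 1%:M -> al = id \/ al = @sigma R.
Proof.
move=> alF r1; have := tau_bound alF; rewrite r1 defect1 => tau1.
set t := tau al in tau1.
have hv : spin al v0 = t *: v0.
  apply/eqP; rewrite -subr_eq0; apply/eqP/sdot_le0.
  rewrite -scaleN1r sdotDl !sdotDr !sdotZl !sdotZr (sdotC v0) spin_dot //.
  rewrite -/(tau al) -/t sdot_v0v0.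
  by rewrite expr2 in tau1; lra.
have ht : t ^+ 2 = 1.
  have := spin_dot alF v0 v0; rewrite hv sdotZl sdotZr sdot_v0v0 => <-; ring.
have spinE s : spin al s = t *: s.
  case: s => y z; rewrite spinor_gen.
  by rewrite spinD // !spin_clifford // r1 !mul1mx hv !cliffordZr scalerDr.
have alE a b v s : al (peirce a b v s) = peirce a b v (t *: s).
  by rewrite stab_peirce // r1 mul1mx spinE.
move/eqP: ht; rewrite sqrf_eq1 => /orP[/eqP tE|/eqP tE]; [left|right]; apply/funext => X;
  rewrite (peirce_coord X) alE tE ?scale1r // scaleN1r sigma_peirce //.
Qed.

(** The determinant is carried along because, in dimension 9, it decides the
    sign between A and the matrix of be. *)
Lemma rot_image A : A^T *m A = 1%:M -> exists2 be, F4_E1 R be &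
  \det (rot be) = 1 /\ (A = rot be \/ A = - rot be).
Proof.
move: A; apply: orthogonal_ind.
- by exists id; [exact: F4_E1_id|rewrite rot_id det1; split=> //; left].
- move=> A [be beF [d1 AE]]; exists be => //; split=> //.
  by case: AE => ->; [right|left; rewrite opprK].
move=> u A u1 [be beF [d1 AE]]; have kF := half_turn_lift_F4_E1 u1.
exists (half_turn_lift u \o be); first exact: F4_E1_comp.
rewrite rot_comp // rot_half_turn_lift // det_mulmx d1 det_half_turn_mx // mulr1; split.
  by rewrite -signr_odd.
by case: AE => ->; [left|right; rewrite mulmxN].
Qed.

(** Otherwise the matrix is minus that of an automorphism be, and the quotient
    of the two automorphisms is a lift of -1. *)
Lemma rot_det al : F4_E1 R al -> \det (rot al) = 1.
Proof.
move=> alF; have [be beF [d1 [->//|rN]]] := rot_image (rot_orth alF).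
have [ga [gaF beK gaK]] := F4_E1_inv beF.
case: (rot_neqN1 (F4_E1_comp gaF alF)).
rewrite rot_comp // rN mulmxN -rot_comp //.
by have -> : ga \o be = id by [apply/funext]; rewrite rot_id.
Qed.

Lemma SO_rot A : SO R 9 A -> exists2 al, F4_E1 R al & rot al = A.
Proof.
move=> [/mulmx1C oA dA]; have [be beF [d1 [AE|AE]]] := rot_image oA.
  by exists be.
move: dA; rewrite AE -scaleN1r detZ d1 mulr1 -signr_odd /= expr1 => /eqP.
by rewrite -subr_eq0 -opprD oppr_eq0 -mulr2n pnatr_eq0.
Qed.

Lemma rot_SO al : F4_E1 R al -> SO R 9 (rot al).
Proof. by move=> alF; split; [exact: mulmx1C (rot_orth alF)|exact: rot_det]. Qed.

End VectorRepresentation.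

(** * The centralizer of sigma, and lifts close to the identity *)

Section SigmaCentralizer.
Variable R : realType.
Local Notation C := (cayley R).
Local Notation J := (jordan R).
Local Notation S := (cayley R * cayley R)%type.
Local Notation V := 'cV[R]_9.
Local Notation sig := (@sigma R).
Local Notation v0 := (@spinor1 R).
Implicit Types al be : J -> J.

Lemma sigmaK : involutive sig.
Proof. by move=> X; rewrite (peirce_coord X) !sigma_peirce opprK. Qed.

Lemma cliffordNr (v : V) (s : S) : clifford v (- s) = - clifford v s.
Proof. by rewrite -scaleN1r cliffordZr scaleN1r. Qed.

Lemma sdotNN (s r : S) : sdot (- s) (- r) = sdot s r.
Proof. by rewrite -(scaleN1r s) -(scaleN1r r) sdotZl sdotZr mulN1r mulN1r opprK. Qed.

Lemma sigma_F4_E1 : F4_E1 R sig.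
Proof.
split; last by rewrite E1_peirce sigma_peirce oppr0.
split.
- move=> t X Y; rewrite (peirce_coord X) (peirce_coord Y) peirceZ peirceD.
  rewrite !sigma_peirce peirceZ peirceD.
  by rewrite opprD scalerN.
- exact: inv_bij sigmaK.
- move=> X Y; rewrite (peirce_coord X) (peirce_coord Y).
  rewrite !sigma_peirce !peirce_mul !sigma_peirce sdotNN.
  have -> (s r : S) : spinor_sq (- s) (- r) = spinor_sq s r.
    by apply/colP => i; rewrite !mxE cliffordNr sdotNN.
  by rewrite !cliffordNr !scalerN -!opprD scalerN.
Qed.

Lemma spin_sigma s : spin sig s = - s.
Proof. by rewrite /spin sigma_peirce; case: (peirceK 0 0 (0 : V) (- s)). Qed.

Lemma rot_sigma : rot sig = 1%:M.
Proof.
apply: rot_uniq => [|v]; first exact: sigma_F4_E1.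
by rewrite mul1mx /of_vec sigma_peirce oppr0.
Qed.

Lemma sigma_central al : F4_E1 R al -> sig \o al = al \o sig.
Proof.
move=> alF; apply/funext => X /=.
rewrite (peirce_coord X) sigma_peirce !(stab_peirce alF) sigma_peirce.
by rewrite spinN.
Qed.

Lemma spinor1_neqN : - v0 <> v0.
Proof.
move=> /(congr1 (fun s => sdot s v0)); rewrite -{1}scaleN1r sdotZl sdot_v0v0; lra.
Qed.

Lemma sigma_neq_id : sig <> id.
Proof.
move=> e; apply: spinor1_neqN; rewrite -spin_sigma e.
by rewrite /spin; case: (peirceK 0 0 (0 : V) v0).
Qed.

Lemma sigma_even X : sig X = X -> spin_part X = 0.
Proof.
move=> h; have := h; rewrite (peirce_coord X) sigma_peirce => /peirce_inj[_ _ _ /eqN_eq0 s0].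
by rewrite s0; case: (peirceK (coefE1 X) (coefE23 X) (vec_part X) (0 : S)).
Qed.

Lemma peirceN a b (v : V) (s : S) : - peirce a b v s = peirce (- a) (- b) (- v) (- s).
Proof. by rewrite -scaleN1r peirceZ !mulN1r !scaleN1r. Qed.

Lemma sigma_odd X : sig X = - X -> X = of_spinor (spin_part X).
Proof.
move=> h; have := h; rewrite (peirce_coord X) sigma_peirce peirceN.
move=> /peirce_inj[a0 b0 /esym/eqN_eq0 w0 _].
have -> : coefE1 X = 0 by lra.
have -> : coefE23 X = 0 by lra.
by rewrite w0 /of_spinor; case: (peirceK 0 0 (0 : V) (spin_part X)) => _ _ _ ->.
Qed.

Lemma of_spinorN s : sig (of_spinor s) = - of_spinor s.
Proof. by rewrite sigma_peirce peirceN !oppr0. Qed.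

Lemma clifford_scalar (v : V) c : (forall s, clifford v s = c *: s) -> v = 0 /\ c = 0.
Proof.
move=> h; have := h v0; have := h (0, creal 1); rewrite /clifford /v0.
rewrite (vec_ofE (erefl (v 0%:I9 0)) (erefl (vec_cayley v))) !vec_ofK.
move: (v 0%:I9 0) (vec_cayley v) => t x e1 e0.
have := congr1 fst e1; have := congr1 snd e1; have := congr1 fst e0 => h3 h2 h1.
have x0 : x = 0.
  move: h1; change (cconj (cmul (creal 1) x) - t *: (0 : C) = c *: (0 : C) -> x = 0).
  rewrite cmul_creall scale1r !scaler0 subr0.
  by move=> e; have := congr1 (@cconj R) e; rewrite cconjK cconj0.
move: (congr1 (@cre R) h2) (congr1 (@cre R) h3) => {}h2 {}h3.
have [tc t0] : t = c /\ t = 0.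
  move: h2 h3; rewrite /cmul /cconj /qmul /qconj /creal /cre x0; cbn => h2 h3; lra.
split; last by rewrite -tc.
by rewrite x0 t0; apply/colP => i; rewrite !mxE; case: i => [[|[|[|[|[|[|[|[|[|//]]]]]]]]] ?].
Qed.

(** The image of E1 is an idempotent of the form a E1 + b (E2 + E3) + v that
    acts on spinors as 1/2. Then v acts on spinors as the scalar 1 - a - b,
    which forces v = 0 and a + b = 1, and a is 0 or 1. *)
Lemma centralizer_E1 al : F4 R al -> sig \o al = al \o sig -> al (E1 R) = E1 R.
Proof.
move=> [al_lin [be alK beK] al_mul] alS.
have al_inj := can_inj alK.
have sal X : sig (al X) = al (sig X) by have := congr1 (fun f => f X) alS.
have sbe X : sig (be X) = be (sig X) by apply: al_inj; rewrite -sal !beK.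
have alZ t X : al (t *: X) = t *: al X.
  have alD Y Z : al (Y + Z) = al Y + al Z by have := al_lin 1 Y Z; rewrite !scale1r.
  have al0 : al 0 = 0 by apply: (@addrI _ (al 0)); rewrite -alD !addr0.
  by have := al_lin t X 0; rewrite !addr0 al0 addr0.
have E1S : sig (E1 R) = E1 R by rewrite E1_peirce sigma_peirce oppr0.
have FE := peirce_coord (al (E1 R)).
rewrite (sigma_even (_ : sig (al (E1 R)) = _)) in FE; last by rewrite sal E1S.
move: (coefE1 _) (coefE23 _) (vec_part _) FE => a b v FE.
have half r : jmul (al (E1 R)) (of_spinor r) = 2^-1 *: of_spinor r.
  have beN X : be (- X) = - be X.
    by apply: al_inj; rewrite beK -[- be X]scaleN1r alZ beK scaleN1r.
  have bo : be (of_spinor r) = of_spinor (spin_part (be (of_spinor r))).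
    by apply: sigma_odd; rewrite sbe of_spinorN beN.
  rewrite -[of_spinor r]beK -al_mul -alZ bo E1_mul; congr al.
  by rewrite /of_spinor peirceZ !mulr0 scaler0.
have act r : clifford v r = (1 - (a + b)) *: r.
  have := half r; rewrite FE peirce_mul peirceZ => /peirce_inj[_ _ _].
  rewrite add0r scaler0 addr0 clifford0r addr0 => /scalerI h.
  rewrite scalerBl scale1r -[X in X - _]h ?invr_eq0 ?pnatr_eq0 //.
  by rewrite addrC addKr.
have [v_0 ab] := clifford_scalar act.
have bE : b = 1 - a by lra.
have aa : a * a = a.
  have := al_mul (E1 R) (E1 R); rewrite {2}E1_peirce E1_mul scaler0 -E1_peirce FE peirce_mul.
  by rewrite sdot0l addr0 => /peirce_inj[].
have [a0|a_neq0] := eqVneq a 0; last first.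
  have a1 : a = 1 by apply: (mulfI a_neq0); rewrite aa mulr1.
  by rewrite FE bE v_0 a1 subrr -E1_peirce.
(* Now the image of E1 is E2 + E3. Pulling back a nonzero vector w to X, the
   equation that E1 o X is a multiple of E1 becomes (E2 + E3) o w = w being a
   multiple of E2 + E3. *)
rewrite a0 v_0 bE a0 subr0 in FE.
pose w : V := delta_mx 0%:I9 0.
have XE := peirce_coord (be (of_vec w)).
rewrite (sigma_even (_ : sig (be (of_vec w)) = _)) in XE; last first.
  by rewrite sbe sigma_peirce oppr0.
move: (coefE1 _) (coefE23 _) (vec_part _) XE => p q x XE.
have := al_mul (E1 R) (be (of_vec w)); rewrite beK {1}XE E1_mul.
have -> : peirce p 0 0 (2^-1 *: 0) = p *: E1 R.
  by rewrite E1_peirce peirceZ mulr1 mulr0 !scaler0.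
rewrite alZ FE peirce_mul peirceZ => /peirce_inj[_ _ wE _].
have := congr1 (fun y : V => y 0%:I9 0) wE.
rewrite spinor_sq0l !mxE !mulr0 !mul1r !addr0 => /eqP.
by rewrite eq_sym !eqxx oner_eq0.
Qed.

Lemma F4_sigmaE : F4_sigma R = F4_E1 R.
Proof.
apply/seteqP; split=> al [alF h]; split=> //; first exact: centralizer_E1.
exact: sigma_central.
Qed.

Lemma tau_comp_sigma al : F4_E1 R al -> tau (sig \o al) = - tau al.
Proof.
move=> alF; rewrite /tau spin_comp //; last exact: sigma_F4_E1.
by rewrite spin_sigma -scaleN1r sdotZl mulN1r.
Qed.

(** The squared norm of c - 2 a + v0 is nonnegative, for the unit spinors
    a = al v0 and c = al be v0; this replaces the triangle inequality for the
    displacements of v0. *)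
Lemma tau_mul al be : F4_E1 R al -> F4_E1 R be ->
  2 * tau al + 2 * tau be - 3 <= tau (al \o be).
Proof.
move=> alF beF.
pose a := spin al v0; pose c := spin al (spin be v0).
have ca : sdot c a = tau be by rewrite spin_dot.
have aa : sdot a a = 1 by rewrite spin_dot // sdot_v0v0.
have cc : sdot c c = 1 by rewrite !spin_dot // sdot_v0v0.
have cE : sdot c v0 = tau (al \o be) by rewrite /tau spin_comp.
have aE : sdot a v0 = tau al by [].
have pos (s : S) : 0 <= sdot s s by rewrite /sdot addr_ge0 // cdot_ge0.
have := pos (c + (-2 *: a + v0)).
rewrite !(sdotDl, sdotDr, sdotZl, sdotZr) (sdotC a c) (sdotC v0 c) (sdotC v0 a).
rewrite ca aa cc cE aE sdot_v0v0; lra.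
Qed.

Lemma rot_fiber al be : F4_E1 R al -> F4_E1 R be -> rot al = rot be ->
  al = be \/ al = sig \o be.
Proof.
move=> alF beF e; have [ga [gaF beK gaK]] := F4_E1_inv beF.
have alE : al = (al \o ga) \o be by apply/funext => X; rewrite /= beK.
have k : rot (al \o ga) = 1%:M.
  rewrite rot_comp // e -rot_comp //.
  by have -> : be \o ga = id by [apply/funext]; rewrite rot_id.
by rewrite alE; case: (rot_ker (F4_E1_comp alF gaF) k) => ->; [left|right].
Qed.

(** One of the two lifts, which differ by sigma, has positive tau, and
    15 / 64 = 1 - (7 / 8)^2. The bound 7 / 8 is large enough for [tau_mul] to
    make tau positive on products. *)
Lemma near_lift A : SO R 9 A -> defect A < 15 / 64 ->
  exists al, [/\ F4_E1 R al, rot al = A & 7 / 8 < tau al].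
Proof.
move=> /SO_rot[al alF <-] dA; have := tau_bound alF => b.
have sq : (7 / 8) ^+ 2 < tau al ^+ 2 by rewrite expr2; lra.
have [t0|t0] := leP 0 (tau al).
  exists al; split=> //.
  by move: sq; rewrite ltr_pXn2r // nnegrE; lra.
exists (sig \o al); split; first exact: F4_E1_comp sigma_F4_E1 alF.
  by rewrite rot_comp //; [rewrite rot_sigma mul1mx|exact: sigma_F4_E1].
rewrite tau_comp_sigma //; move: sq; rewrite -(sqrrN (tau al)) ltr_pXn2r // nnegrE; lra.
Qed.

Lemma near_lift_uniq al be : F4_E1 R al -> F4_E1 R be -> rot al = rot be ->
  0 < tau al -> 0 < tau be -> al = be.
Proof.
move=> alF beF e ta tb; case: (rot_fiber alF beF e) => // alE.
by move: ta; rewrite alE tau_comp_sigma // oppr_gt0 => /lt_trans/(_ tb); rewrite ltxx.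
Qed.

End SigmaCentralizer.

(** * The stabilizer of E1 as a group *)

Section StabGroup.
Variable R : realType.

(** [F4_E1] bundled as a type, which carries the group structure required of
    the target of [local_hom_extension]. *)
Record stab := Stab { stab_fun :> jordan R -> jordan R; stabP : F4_E1 R stab_fun }.

Lemma stab_eq (a b : stab) : stab_fun a = b -> a = b.
Proof.
case: a b => [a aP] [b bP] /= e; case: _ / e bP => bP.
by congr Stab; exact: Prop_irrelevance.
Qed.

HB.instance Definition _ := gen_eqMixin stab.
HB.instance Definition _ := gen_choiceMixin stab.

Definition stab_one : stab := Stab (@F4_E1_id R).
Definition stab_mul (a b : stab) : stab := Stab (F4_E1_comp (stabP a) (stabP b)).
Definition stab_inv (a : stab) : stab :=
  let h := cid (F4_E1_inv (stabP a)) in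
  Stab (let: And3 bF _ _ := projT2 h in bF).

Fact stab_mulA : associative stab_mul.
Proof. by move=> a b c; exact: stab_eq. Qed.
Fact stab_mul1 : left_id stab_one stab_mul.
Proof. by move=> a; exact: stab_eq. Qed.
Fact stab_1mul : right_id stab_one stab_mul.
Proof. by move=> a; exact: stab_eq. Qed.
Fact stab_mulV : left_inverse stab_one stab_inv stab_mul.
Proof.
move=> a; apply: stab_eq; apply/funext => X; rewrite /= /stab_inv.
by case: cid => b [bF ab ba] /=.
Qed.
Fact stab_mulVr : right_inverse stab_one stab_inv stab_mul.
Proof.
move=> a; apply: stab_eq; apply/funext => X; rewrite /= /stab_inv.
by case: cid => b [bF ab ba] /=.
Qed.

HB.instance Definition _ := isGroup.Build stab
  stab_mulA stab_mul1 stab_1mul stab_mulV stab_mulVr.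

End StabGroup.

(** * Comparison with the universal double covering group *)

Section CoveringGroup.
Variables (R : realType) (G : topologicalGroupType) (p : G -> 'M[R]_9).
Local Notation V := 'cV[R]_9.
Local Notation S := (cayley R * cayley R)%type.
Local Notation v0 := (@spinor1 R).

(** The coefficients are polynomial in the entries of the matrix. Quantifying
    over the linear form phi lets the induction remove the outermost letter. *)
Lemma clifford_word_continuous ks (phi : S -> R) :
    (forall t s s', phi (t *: s + s') = t * phi s + phi s') -> continuous p ->
  continuous (fun x => phi (clifford_word (p x) ks v0)).
Proof.
move=> + pc; elim: ks phi => [|k ks IH] phi phiP x; first exact: cvg_cst.
have phiD s s' : phi (s + s') = phi s + phi s'.
  by have := phiP 1 s s'; rewrite scale1r mul1r.
have phi0 : phi 0 = 0 by apply: (@addrI _ (phi 0)); rewrite -phiD !addr0.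
have phiZ t s : phi (t *: s) = t * phi s by have := phiP t s 0; rewrite !addr0 phi0 addr0.
have cE A s : phi (clifford (col k A) s) = \sum_i A i k * phi (clifford (delta_mx i 0) s).
  rewrite (matrix_sum_delta (col k A)).
  rewrite (@big_morph _ _ (fun v => phi (clifford v s)) 0 +%R 0 +%R) /=.
  - apply: eq_bigr => i _.
    by rewrite big_ord1 mxE cliffordZl phiZ.
  - by move=> v w; rewrite cliffordDl phiD.
  - by rewrite clifford0l phi0.
have -> : (fun x => phi (clifford_word (p x) (k :: ks) v0)) =
    (fun x => \sum_i p x i k * phi (clifford (delta_mx i 0) (clifford_word (p x) ks v0))).
  by apply/funext => y; rewrite /= cE.
apply: (@continuous_big R _ +%R 0 xpredT (@add_continuous R) G _
  (fun i x => p x i k * phi (clifford (delta_mx i 0) (clifford_word (p x) ks v0)))) => i _ y.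
apply: cvgM; last first.
  apply: (IH (fun s => phi (clifford (delta_mx i 0) s))) => t s s'.
  by rewrite cliffordDr cliffordZr phiP.
apply: (@cvg_comp _ _ _ p (fun M : 'M[R]_9 => M i k) _ (nbhs (p y))); first exact: pc.
exact: coord_continuous.
Qed.

Lemma defect_continuous : continuous p -> continuous (fun x => defect (p x)).
Proof.
move=> pc; have lin (t : R) s s' : sdot (t *: s + s') v0 = t * sdot s v0 + sdot s' v0.
  by rewrite sdotDl sdotZl.
have c ks := @clifford_word_continuous ks (fun s => sdot s v0) lin pc.
rewrite /defect => x; apply: cvgM; first exact: cvg_cst.
apply: cvgD; first by apply: cvgD; [exact: cvg_cst|exact: c].
apply: (@continuous_big R _ +%R 0 xpredT (@add_continuous R) G _
  (fun ks x => 1 - sdot (clifford_word (p x) ks v0) v0)) => ks _ y.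
by apply: cvgB; [exact: cvg_cst|exact: c].
Qed.

Hypothesis spinG : universal_double_covering_SO p.

Let pM x y : p (x * y)%g = p x *m p y. Proof. by case: spinG. Qed.
Let pc : continuous p. Proof. by case: spinG => _ []. Qed.
Let p_range : range p = SO R 9. Proof. by case: spinG => _ []. Qed.

Let p_SO x : SO R 9 (p x). Proof. by rewrite -p_range; exists x. Qed.

Let p1 : p 1%g = 1%:M.
Proof.
have [/mulmx1C o _] := p_SO 1%g.
have := pM 1%g 1%g; rewrite mulg1 => /(congr1 (mulmx (p 1%g)^T)).
by rewrite mulmxA o mul1mx.
Qed.

Lemma lift_to_stabilizer : exists phi : G -> stab R,
  (forall x y, phi (x * y)%g = (phi x * phi y)%g) /\ forall x, rot (phi x) = p x.
Proof.
pose U : set G := [set x | defect (p x) < 15 / 64].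
have near x : exists a : stab R, U x -> rot a = p x /\ 7 / 8 < tau a.
  have [Ux|nUx] := pselect (U x); last by exists 1%g.
  by have [al [alF ? ?]] := near_lift (p_SO x) Ux; exists (Stab alF).
have [f fP] := choice near.
have U1 : nbhs (1%g : G) U.
  have := @defect_continuous pc 1%g [set t : R | t < 15 / 64].
  by apply; rewrite /= p1 defect1; apply: lt_nbhsl; lra.
have fM x y : U x -> U y -> U (x * y)%g -> f (x * y)%g = (f x * f y)%g.
  move=> /fP[rx tx] /fP[ry ty] /fP[rxy txy].
  apply/stab_eq/near_lift_uniq; try exact: stabP.
  - by rewrite rxy pM -rx -ry -rot_comp //; exact: stabP.
  - lra.
  - by have := tau_mul (stabP (f x)) (stabP (f y)); rewrite /=; lra.
have simG : simply_connected R G by case: spinG.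
have [phi [phiM phiQ]] := local_hom_extension simG U1 fM.
exists phi; split=> // x.
apply: (phiQ (fun x a => rot (stab_fun a) = p x)) => [|y z a b ya zb|v /fP[]//].
  by rewrite p1 rot_id.
by rewrite pM -ya -zb -rot_comp //; exact: stabP.
Qed.

Definition stab_sigma : stab R := Stab (@sigma_F4_E1 R).

(** Orthogonal vectors anticommute in the Clifford algebra, while the half
    turns about them commute. *)
Lemma anticommuting_pair : exists a b : stab R, (a * b = stab_sigma * (b * a))%g.
Proof.
pose u : V := delta_mx 0%:I9 0; pose w : V := delta_mx 1%:I9 0.
have u1 : vdot u u = 1 by rewrite vdot_delta mxE !eqxx.
have w1 : vdot w w = 1 by rewrite vdot_delta mxE !eqxx.
have uw : vdot u w = 0 by rewrite vdot_delta mxE.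
exists (Stab (half_turn_lift_F4_E1 u1)), (Stab (half_turn_lift_F4_E1 w1)).
apply: stab_eq; apply/funext => X /=; rewrite (peirce_coord X) !half_turn_lift_peirce sigma_peirce.
have -> : clifford u (clifford w (spin_part X)) = - clifford w (clifford u (spin_part X)).
  by apply/eqP; rewrite -addr_eq0 clifford_anti uw mulr0 scale0r.
congr peirce; rewrite /half_turn; move: (vec_part X) => v.
rewrite -!(scaleN1r v) !vdotDr !vdotZr (vdotC w u) uw.
by apply/colP => i; rewrite !mxE; ring.
Qed.

Lemma stab_fiber (a b : stab R) : rot a = rot b -> a = b \/ a = (stab_sigma * b)%g.
Proof.
by move=> e; case: (rot_fiber (stabP a) (stabP b) e) => h; [left|right]; apply: stab_eq.
Qed.

Lemma stab_sigma_central (a : stab R) : (stab_sigma * a = a * stab_sigma)%g.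
Proof. by apply: stab_eq; exact: sigma_central (stabP a). Qed.

Lemma stab_sigma_neq1 : stab_sigma <> 1%g.
Proof. by move=> /(congr1 (@stab_fun R)); exact: sigma_neq_id. Qed.

(** Since phi lies over the identity of SO(9), its kernel is in that of p and
    its image meets every fibre of [rot]; both questions come down to the
    element c of G with phi c = sigma. *)
Lemma lift_bij (phi : G -> stab R) :
  (forall x y, phi (x * y)%g = (phi x * phi y)%g) -> (forall x, rot (phi x) = p x) ->
  bijective phi.
Proof.
move=> phiM phiQ.
have phi1 : phi 1%g = 1%g by apply: (mulgI (phi 1%g)); rewrite -phiM !mulg1.
have rotK A : SO R 9 A -> exists x, p x = A.
  by rewrite -p_range => -[x _ <-]; exists x.
(* The sign ambiguity in phi x and phi y cancels in their commutator, which
   is therefore sigma. *)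
have [c cE] : exists c, phi c = stab_sigma.
  have [a [b ab]] := anticommuting_pair.
  have [x xE] := rotK _ (rot_SO (stabP a)); have [y yE] := rotK _ (rot_SO (stabP b)).
  have comm : (phi x * phi y = stab_sigma * (phi y * phi x))%g.
    have sCA (d e : stab R) : (d * (stab_sigma * e) = stab_sigma * (d * e))%g.
      by rewrite !mulgA stab_sigma_central.
    have := stab_fiber (etrans (phiQ x) xE); have := stab_fiber (etrans (phiQ y) yE).
    move=> [->|->] [->|->] //.
    - by rewrite -!mulgA ab (sCA b).
    - by rewrite -!mulgA (sCA a) ab.
    - by rewrite -!mulgA (sCA a) ab (sCA b).
  exists ((x * y) * (y * x)^-1)%g; apply: (mulIg (phi (y * x)%g)).
  by rewrite -phiM mulgVK !phiM.
have pc1 : p c = 1%:M by rewrite -phiQ cE rot_sigma.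
have c_neq1 : c <> 1%g by move=> c1; apply: stab_sigma_neq1; rewrite -cE c1.
have ker z : p z = 1%:M -> z = 1%g \/ z = c.
  move=> pz; have [_ _ _ /(_ 1%:M)] := spinG.
  rewrite -{1}p1 => /(_ (p_SO _))/eq_cardSP[x _ /eq_cardSP[y _]].
  rewrite II0 card_eq0 => /eqP fib0.
  have fib t : p t = 1%:M -> t = x \/ t = y.
    move=> pt; apply: contrapT => /not_orP[tx ty].
    by have : (p @^-1` [set 1%:M] `\ x `\ y) t by []; rewrite fib0.
  by case: (fib _ pz) => ->; case: (fib _ p1) => e1; case: (fib _ pc1) => ec;
    rewrite ?e1 ?ec; auto; case: c_neq1; rewrite e1 ec.
have phi_inj : injective phi.
  move=> x y xy; apply: (mulgI x^-1%g); rewrite mulVg; symmetry.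
  have e1 : phi (x^-1 * y)%g = 1%g by rewrite phiM -xy -phiM mulVg phi1.
  case: (ker (x^-1 * y)%g) => //; first by rewrite -phiQ e1 rot_id.
  by move=> zc; case: stab_sigma_neq1; rewrite -cE -zc e1.
have phi_surj a : exists x, phi x = a.
  have [x xE] := rotK _ (rot_SO (stabP a)).
  case: (stab_fiber (esym (etrans (phiQ x) xE))) => ->; first by exists x.
  by exists (c * x)%g; rewrite phiM cE.
have [psi psiP] := choice phi_surj.
exists psi => // x; exact: phi_inj.
Qed.

Lemma stabilizer_iso_Spin9 : isomorphic_to (F4_E1 R) G.
Proof.
have [phi [phiM phiQ]] := lift_to_stabilizer.
have [psi phiK psiK] := lift_bij phiM phiQ.
pose f (al : jordan R -> jordan R) : G :=
  if pselect (F4_E1 R al) is left h then psi (Stab h) else 1%g.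
have fE (a : stab R) : f a = psi a.
  rewrite /f; case: pselect => [h|[]]; last exact: stabP.
  by congr psi; exact: stab_eq.
have fM (a b : stab R) : f (a \o b) = (f a * f b)%g.
  rewrite -[a \o b]/(stab_fun (a * b)%g) !fE; apply: (can_inj phiK).
  by rewrite phiM !psiK.
exists f; split; last by move=> a b aF bF; exact: (fM (Stab aF) (Stab bF)).
split=> [//|a b /set_mem aF /set_mem bF|x _].
  have := fE (Stab aF); have := fE (Stab bF) => /= -> -> /(can_inj psiK).
  by move/(congr1 (@stab_fun R)).
by exists (phi x); [exact: stabP|rewrite fE phiK].
Qed.
End CoveringGroup.

Theorem theorem2p9p1 (R : realType) :
  F4_sigma R = F4_E1 R /\
  forall Spin9 : topologicalGroupType, is_Spin R 9 Spin9 ->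
    isomorphic_to (F4_E1 R) Spin9.
Proof.
split; first exact: F4_sigmaE.
by move=> Spin9 [p spinG]; exact: stabilizer_iso_Spin9 spinG.
Qed.
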